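(* Let $\mu,\nu\in\mathcal M_+(\Omega)$ with $\mu\ll dx$, $\nu\ll dy$, $\frac{d\mu}{dx}\in L_1(\Omega,dx)$, $\frac{d\nu}{dy}\in L_1(\Omega,dy)$, let $\lambda_1,\lambda_2:\Omega\to\mathbb R_+$ be bounded measurable functions, let $\epsilon>0$ and $K=e^{-c/\epsilon}$. Let the first penalty $P_1(\gamma_1)$ be either $TV(\lambda_1\gamma_1\parallel\lambda_1\mu)$ or $\overline{PTV}(\lambda_1\gamma_1\parallel\lambda_1\mu)$, and let the second penalty $P_2(\gamma_2)$ be either $TV(\lambda_2\gamma_2\parallel\lambda_2\nu)$ or $\overline{PTV}(\lambda_2\gamma_2\parallel\lambda_2\nu)$ (the two choices being independent). Define the entropic generalized optimal partial transport value $$EGOPT=\inf_{\gamma\in\mathcal M_+(\Omega^2),\ \gamma\ll dxdy}\ \int_{\Omega^2} c\,d\gamma+\epsilon\int_{\Omega^2}\Big(\ln\Big(\frac{d\gamma}{dxdy}\Big)-1\Big)\frac{d\gamma}{dxdy}\,dxdy+P_1(\gamma_1)+P_2(\gamma_2).$$ Then $$EGOPT+\epsilon\int_{\Omega^2}K\,dxdy=\sup_{\phi\in L_\infty(\Omega,dx),\ \psi\in L_\infty(\Omega,dy)}\ -\epsilon\int_{\Omega^2}\big(e^{\frac{\phi(x)+\psi(y)}{\epsilon}}-1\big)K(x,y)\,dxdy+Q_1(\phi)+Q_2(\psi),$$ where $$Q_1(\phi)=\begin{cases}\int\min(\phi,\lambda_1)\,d\mu-\iota_{\mathcal S(\lambda_1,dx)}(\phi)&\text{if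 } P_1(\gamma_1)=TV(\lambda_1\gamma_1\parallel\lambda_1\mu),\\ \int\min(\phi,\lambda_1)\,d\mu&\text{if }P_1(\gamma_1)=\overline{PTV}(\lambda_1\gamma_1\parallel\lambda_1\mu),\end{cases}$$ $$Q_2(\psi)=\begin{cases}\int\min(\psi,\lambda_2)\,d\nu-\iota_{\mathcal S(\lambda_2,dy)}(\psi)&\text{if } P_2(\gamma_2)=TV(\lambda_2\gamma_2\parallel\lambda_2\nu),\\ \int\min(\psi,\lambda_2)\,d\nu&\text{if }P_2(\gamma_2)=\overline{PTV}(\lambda_2\gamma_2\parallel\lambda_2\nu),\end{cases}$$ with $$\mathcal S(\lambda_1,dx)=\{\phi\in L_\infty(\Omega,dx):\ \phi\ge-\lambda_1\ dx\text{-a.e., and }\phi=0\ dx\text{-a.e. on }\{\lambda_1=0\}\}$$ and $\mathcal S(\lambda_2,dy)=\{\psi\in L_\infty(\Omega,dy):\ \psi\ge-\lambda_2\ dy\text{-a.e., and }\psi=0\ dy\text{-a.e. on }\{\lambda_2=0\}\}$.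
   Context: $\Omega\subset\mathbb R^d$ is a non-empty convex open set; $\mathbb R_+=[0,\infty)$; $c:\Omega^2\to\mathbb R_+$ is lower semicontinuous. $\mathcal M_+$ denotes positive Radon measures. $dx$ and $dy$ denote fixed reference probability measures on $\Omega$ (not necessarily Lebesgue measure), and $dxdy=dx\otimes dy$ is their product on $\Omega^2$. For $\gamma\in\mathcal M_+(\Omega^2)$, $\gamma_1,\gamma_2$ are its first and second marginals. $\lambda_1\gamma_1$ denotes the measure with density $\lambda_1$ with respect to $\gamma_1$, and similarly for the other products. For a set $A$, $\iota_A(z)=0$ if $z\in A$ and $+\infty$ otherwise. The convention $0\ln 0=0$ is used. For nonnegative measures $\alpha,\beta$ on $\Omega$: - $TV(\alpha\parallel\beta)=\int d|\alpha-\beta|$ (total variation); - $PTV(\alpha\parallel\beta)=\int d|\beta-\alpha|$ if $\alpha\le\beta$ (setwise), and $+\infty$ otherwise; - $\iota_\le(\alpha\parallel\beta)=0$ if $\alpha\le\beta$, and $+\infty$ otherwise; - $\overline{PTV}(\lambda_1\gamma_1\parallel\lambda_1\mu)=PTV(\lambda_1\gamma_1\parallel\lambda_1\mu)+\iota_\le(\gamma_1\parallel\mu)$, and $\overline{PTV}(\lambda_2\gamma_2\parallel\lambda_2\nu)=PTV(\lambda_2\gamma_2\parallel\lambda_2\nu)+\iota_\le(\gamma_2\parallel\nu)$. *)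

(* Defs.v *)
From HB Require Import structures.
From mathcomp Require Import all_boot all_order all_algebra.
From mathcomp Require Import all_classical all_reals all_analysis.
Import Order.TTheory GRing.Theory Num.Theory.
Import numFieldNormedType.Exports.

Set Implicit Arguments.
Unset Strict Implicit.
Unset Printing Implicit Defensive.

Local Open Scope classical_set_scope.
Local Open Scope ring_scope.
Local Open Scope ereal_scope.

(* R^d carries its Borel sigma-algebra.  As R^d is second countable, the
   product sigma-algebra on R^d * R^d is its Borel sigma-algebra too. *)
HB.instance Definition _ (R : realType) (d : nat) :=
  Measurable.copy 'rV[R]_d (g_sigma_algebraType (@open 'rV[R]_d)).

(* A measure on a Borel subset D of X is encoded as a measure on X that vanishes
   outside D; a function on D as a function on X of which only the values on D
   are used.  On open subsets of Euclidean spaces, Borel measures that are finite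
   on compact sets are automatically regular. *)
Definition radon_on (X : topologicalType) (R : realType) (D : set X)
    (m : set X -> \bar R) : Prop :=
  m (~` D) = 0 /\ forall C, compact C -> C `<=` D -> m C < +oo.

(* The library's 'd nu '/d mu requires nu to be finite; here nu is only required
   to be sigma-finite.  The derivative is unique mu-almost everywhere. *)
Definition is_density (disp : measure_display) (T : measurableType disp)
    (R : realType) (nu mu : set T -> \bar R) (p : T -> R) : Prop :=
  [/\ measurable_fun [set: T] p, (forall x, (0 <= p x)%R) &
      forall A, measurable A -> nu A = \int[mu]_(x in A) (p x)%:E].

Definition density (disp : measure_display) (T : measurableType disp)
    (R : realType) (nu mu : set T -> \bar R) : T -> R :=
  xget (fun=> 0%R) [set p | is_density nu mu p].

Definition iota_ind (R : realType) (P : Prop) : \bar R :=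
  if `[< P >] then 0 else +oo.

Section penalties.
Variables (disp : measure_display) (T : measurableType disp) (R : realType).
Implicit Types alpha beta : set T -> \bar R.

Definition weighted (D : set T) (l : T -> R) alpha : set T -> \bar R :=
  fun A => \int[alpha]_(x in A `&` D) (l x)%:E.

(* Mass of |alpha - beta|, computed over finite measurable partitions rather than
   with the library's charge_variation because alpha or beta may be infinite (one
   of them is finite wherever this is used). *)
Definition TV alpha beta : \bar R :=
  ereal_sup [set s | exists (n : nat) (F : 'I_n -> set T),
    [/\ forall i, measurable (F i), trivIset [set: 'I_n] F,
        \bigcup_(i in [set: 'I_n]) F i = [set: T] &
        s = \sum_(i < n) `|alpha (F i) - beta (F i)|]].

Definition setwise_le alpha beta : Prop :=
  forall A, measurable A -> alpha A <= beta A.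

Definition PTV alpha beta : \bar R :=
  if `[< setwise_le alpha beta >] then TV beta alpha else +oo.

Definition PTVbar (D : set T) (l : T -> R) alpha beta : \bar R :=
  PTV (weighted D l alpha) (weighted D l beta) +
  iota_ind R (setwise_le alpha beta).

Variant penalty := PenTV | PenPTVbar.

Definition primal_penalty (t : penalty) (D : set T) (l : T -> R) alpha beta :=
  match t with
  | PenTV => TV (weighted D l alpha) (weighted D l beta)
  | PenPTVbar => PTVbar D l alpha beta
  end.

Definition dual_constraint (D : set T) (l : T -> R)
    (ref : {measure set T -> \bar R}) : set (T -> R) :=
  [set phi | [/\ phi \in Lfun ref +oo,
    {ae ref, forall x, D x -> (- l x <= phi x)%R} &
    {ae ref, forall x, D x -> l x = 0%R -> phi x = 0%R}]].

Definition dual_term (t : penalty) (D : set T) (l : T -> R)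
    (ref m : {measure set T -> \bar R}) (phi : T -> R) : \bar R :=
  match t with
  | PenTV => \int[m]_(x in D) (Num.min (phi x) (l x))%:E
             - iota_ind R (dual_constraint D l ref phi)
  | PenPTVbar => \int[m]_(x in D) (Num.min (phi x) (l x))%:E
  end.

End penalties.

Section EGOPT.
Variables (R : realType) (d : nat).
Local Notation E := 'rV[R]_d.
Variables (Omega : set E) (dx dy : probability E R).
Variables (c : E * E -> R) (eps : R).
Variables (mu nu : {measure set E -> \bar R}) (l1 l2 : E -> R) (t1 t2 : penalty).

Definition gibbs (z : E * E) : R := expR (- c z / eps).

(* ln is total in the library, so the integrand is 0 where the density is 0. *)
Definition entropy (gamma : {measure set (E * E) -> \bar R}) : \bar R :=
  let p := density gamma (dx \x dy) in
  \int[dx \x dy]_(z in Omega `*` Omega) ((ln (p z) - 1) * p z)%:E.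

Definition primal_cost (gamma : {measure set (E * E) -> \bar R}) : \bar R :=
  \int[gamma]_(z in Omega `*` Omega) (c z)%:E + eps%:E * entropy gamma
  + primal_penalty t1 Omega l1 (pushforward gamma fst) mu
  + primal_penalty t2 Omega l2 (pushforward gamma snd) nu.

Definition EGOPT : \bar R :=
  ereal_inf [set primal_cost gamma | gamma in
    [set gamma : {measure set (E * E) -> \bar R} |
      radon_on (Omega `*` Omega) gamma /\ gamma `<< (dx \x dy)]].

Definition dual_value (phi psi : E -> R) : \bar R :=
  - (eps%:E * \int[dx \x dy]_(z in Omega `*` Omega)
       ((expR ((phi z.1 + psi z.2) / eps) - 1) * gibbs z)%:E)
  + dual_term t1 Omega l1 dx mu phi + dual_term t2 Omega l2 dy nu psi.

End EGOPT.

(* Main.v *)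
From HB Require Import structures.
Require Import Defs.
From mathcomp Require Import all_boot all_order all_algebra.
From mathcomp Require Import all_classical all_reals all_analysis.
From mathcomp Require Import measurable_realfun ess_sup_inf ring lra.
Import Order.TTheory GRing.Theory Num.Theory.
Import numFieldNormedType.Exports.

(** The value of the primal problem, shifted by eps times the mass of
    K = exp (- c / eps), is eps KL(p | K) plus the two penalties, where p is the
    density of the plan with respect to rho = dx \x dy.

    Weak duality is the Fenchel-Young inequality t w <= (ln t - 1) t + exp w
    ([entropy_young]) applied at t = p and w = (phi + psi - c) / eps, together with
    the pointwise inequality between a penalty and its conjugate ([penalty_ge]).
    A plan of the problem is only a Radon measure on an open set; sigma-compactness
    of that set provides its density ([density_exists], [compact_base_cover]), and
    finite entropy then makes the plan finite ([weak_duality]).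

    Strong duality is obtained without weak compactness, by looking only at
    near-maximisers of the dual.  Let the potentials range over the box
    a <= phi <= lambda, where a = - lambda for the TV penalty and a = - M for the
    other one.  The dual is bounded there, and a near-maximiser (phi, psi) satisfies
    the first-order conditions up to a small error ([dual_first_order]).  Let
    p = exp ((phi + psi) / eps) K be the associated Gibbs plan, with marginal
    densities u and v.  Since eps ln (p / K) = phi + psi, the
    primal value at p minus the dual value at (phi, psi) is the sum of
    the gaps, penalty (u) - int phi (f - u), where f is the density of mu, and the
    analogous term for v.  For TV penalties these gaps are exactly the first-order
    errors.  For the other penalty u <= f may fail, and p is multiplied by
    min (1, f / u) ([one_sided_repair]); as u > f is only possible where phi is
    close to - M, up to the first-order error, and there p is exponentially small,
    the mass removed is O(1 / M).  Repairing one marginal decreases the other one;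
    this costs lambda - phi per unit of mass, a factor which is large only where p
    is exponentially small ([cross_excess]).  Letting M tend to infinity closes the
    gap ([no_duality_gap]). *)

Set Implicit Arguments.
Unset Strict Implicit.
Unset Printing Implicit Defensive.

Local Open Scope classical_set_scope.
Local Open Scope ring_scope.

(** * Countable compact bases and Borel sets of pairs *)

(** Such a base B writes every open set as a countable union of compact
    sets belonging to m.  It makes open sets of pairs measurable for the
    product sigma-algebra, and Radon measures on open sets sigma-finite. *)
Definition has_compact_base (X : topologicalType) (m : set (set X)) : Prop :=
  exists B : nat -> set X,
  (forall k, m (B k) /\ compact (B k)) /\
  (forall U x, open U -> U x -> exists k, B k x /\ B k `<=` U).

Lemma has_compact_base_countable (X : topologicalType) (m : set (set X))
    (I : countType) (B : I -> set X) :
  m set0 -> (forall i, m (B i) /\ compact (B i)) ->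
  (forall U x, open U -> U x -> exists i, B i x /\ B i `<=` U) ->
  has_compact_base m.
Proof.
move=> m0 mB bB.
exists (fun k => if unpickle k is Some i then B i else set0); split.
  by move=> k; case: unpickle => [i|]; [exact: mB|split => //; exact: compact0].
move=> U x oU Ux; have [i Bi] := bB U x oU Ux.
by exists (pickle i); rewrite pickleK.
Qed.

Lemma open_measurable_rV (R : realType) (d : nat) (U : set 'rV[R]_d) :
  open U -> measurable U.
Proof. by move=> oU; exact: (@sub_sigma_algebra _ setT (@open 'rV[R]_d) _ oU). Qed.

(** The base consists of the closed cubes with rational centre and radius
    the inverse of a positive integer. *)
Lemma compact_base_rV (R : realType) (d : nat) :
  has_compact_base (@measurable _ 'rV[R]_d).
Proof.
pose B (i : 'rV[rat]_d * nat) : set 'rV[R]_d :=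
  [set v | forall j, `[ratr (i.1 ord0 j) - i.2.+1%:R^-1,
                        ratr (i.1 ord0 j) + i.2.+1%:R^-1]%classic (v ord0 j)].
have cB i : compact (B i).
  have := (@rV_compact R d (fun j => `[ratr (i.1 ord0 j) - i.2.+1%:R^-1,
    ratr (i.1 ord0 j) + i.2.+1%:R^-1]%classic)) (fun j => @segment_compact _ _ _).
  exact.
apply: (@has_compact_base_countable _ _ _ B).
- exact: measurable0.
- move=> i; split; last exact: cB.
  rewrite -(setCK (B i)); apply: measurableC.
  have oC : open (~` B i).
    by apply: closed_openC; apply: compact_closed => //; exact: norm_hausdorff.
  exact: open_measurable_rV.
- move=> U x oU Ux.
  have /nbhs_ballP[e /= e0 xeU] : nbhs x U by exact: open_nbhs_nbhs.
  (* Two points of a cube of radius r are at distance at most 2 r. *)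
  have [n ne] : exists n : nat, n.+1%:R^-1 < e / 2 :> R.
    have [n _ nP] := near_infty_natSinv_lt (PosNum (divr_gt0 e0 (@ltr0n R 2))).
    by exists n; apply: (nP n) => /=.
  have itv_swap (a b r : R) : a - r < b -> b < a + r -> b - r <= a <= b + r.
    by move=> ? ?; apply/andP; split; lra.
  have itv_dist (a b s r : R) : a - r < s -> s < a + r ->
      s - r <= b -> b <= s + r -> `|a - b| <= 2 * r.
    by move=> ? ? ? ?; rewrite ler_norml; apply/andP; split; lra.
  have qx j : exists q : rat, ratr q \in `]x ord0 j - n.+1%:R^-1, x ord0 j + n.+1%:R^-1[.
    by apply: rat_in_itvoo; rewrite ltrD2l gtrN// invr_gt0.
  have [q qP] := choice qx.
  exists (\row_j q j, n); split.
    move=> j /=; rewrite !mxE in_itv/=.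
    have := qP j; rewrite in_itv/= => /andP[]; exact: itv_swap.
  move=> y By; apply: xeU; rewrite mx_norm_ball /ball_ /=.
  apply: (le_lt_trans (y := 2 * n.+1%:R^-1)); last by rewrite mulrC -ltr_pdivlMr.
  rewrite /Num.norm/= mx_normrE; apply/bigmax_leP; split; first by rewrite mulr_ge0.
  move=> [i j] _ /=; rewrite !mxE (ord1 i).
  have := By j; rewrite /= !mxE in_itv/= => /andP[].
  have := qP j; rewrite in_itv/= => /andP[].
  exact: itv_dist.
Qed.


Lemma compact_base_prod (X Y : topologicalType) (mX : set (set X))
    (mY : set (set Y)) (m : set (set (X * Y))) :
  m set0 -> (forall A B, mX A -> mY B -> m (A `*` B)) ->
  has_compact_base mX -> has_compact_base mY -> has_compact_base m.
Proof.
move=> m0 mAB [A [mA bA]] [B [mB bB]].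
apply: (@has_compact_base_countable _ _ _ (fun i : nat * nat => A i.1 `*` B i.2)) => //.
  move=> [i j] /=; have [? ?] := mA i; have [? ?] := mB j.
  by split; [exact: mAB|exact: compact_setX].
move=> U [x y] oU Uxy.
have [[P Q] /= [Px Qy] PQU] : nbhs (x, y) U by exact: open_nbhs_nbhs.
have [k [Akx AkP]] := bA _ _ (@open_interior _ P) Px.
have [l [Bly BlQ]] := bB _ _ (@open_interior _ Q) Qy.
exists (k, l); split => // -[x' y'] [/= Ax By]; apply: PQU; split => /=.
  exact: interior_subset (AkP _ Ax).
exact: interior_subset (BlQ _ By).
Qed.

Lemma compact_base_cover (X : topologicalType) (m : set (set X)) (U : set X) :
  m set0 -> has_compact_base m -> open U ->
  exists C : nat -> set X,
    (forall k, [/\ m (C k), compact (C k) & C k `<=` U]) /\ U = \bigcup_k C k.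
Proof.
move=> m0 [B [mB bB]] oU.
exists (fun k => if `[< B k `<=` U >] then B k else set0); split.
  move=> k; case: asboolP => BU; first by have [] := mB k.
  by split => //; exact: compact0.
apply/seteqP; split=> [x Ux|x [k _]].
  by have [k [Bk BkU]] := bB U x oU Ux; exists k => //; rewrite asboolT.
by case: asboolP => // BU /BU.
Qed.

Section borel_pairs.
Variables (R : realType) (d : nat).
Local Notation E := 'rV[R]_d.

Lemma compact_base_rV2 : has_compact_base (@measurable _ (E * E)%type).
Proof.
apply: compact_base_prod (compact_base_rV R d) (compact_base_rV R d).
  exact: measurable0.
by move=> A B mA mB; exact: measurableX.
Qed.

Lemma open_measurable_rV2 (U : set (E * E)) : open U -> measurable U.
Proof.
move=> oU; have [C [CP ->]] := compact_base_cover (@measurable0 _ _) compact_base_rV2 oU.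
by apply: bigcup_measurable => k _; have [] := CP k.
Qed.

(** The strict superlevel sets of c are open in U, hence open. *)
Lemma lsc_measurable (U : set (E * E)) (c : E * E -> R) : open U ->
  lower_semicontinuous ((fun z => (c z)%:E) : subspace U -> \bar R) ->
  measurable_fun U c.
Proof.
move=> oU lsc; apply/measurable_EFinP => mU.
apply: (measurability _ (ErealGenOInfty.measurableE R)) => //.
move=> _ [_ [a ->] <-].
apply: open_measurable_rV2; rewrite openE => z [Uz]; rewrite /= in_itv/= andbT => acz.
have [V Vz VP] := lsc z a acz.
have : within U (nbhs z) V by rewrite nbhs_subspace_in.
rewrite /within/= => Vz'; near=> y.
have Uy : U y by near: y; exact: open_nbhs_nbhs.
split => //=; rewrite in_itv/= andbT; apply: VP; exact: (near Vz' y).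
Unshelve. all: by end_near. Qed.


Lemma compact_measurable_rV2 (C : set (E * E)) : compact C -> measurable C.
Proof.
have hausEE : hausdorff_space (E * E)%type by exact: norm_hausdorff.
move=> cC; have clC : closed C by exact: compact_closed.
rewrite -(setCK C); exact: (measurableC (open_measurable_rV2 (closed_openC clC))).
Qed.

Lemma open_setX (A B : set E) : open A -> open B -> open (A `*` B).
Proof.
rewrite !openE => oA oB [x y] [/= /oA Ax /oB By].
by exists (A, B).
Qed.

End borel_pairs.

(** * Real integrals of bounded and of integrable functions *)

(** Integrability as a predicate on the real-valued function itself: unification
    then never has to see through the composition with EFin. *)
Definition L1 {disp : measure_display} {T : measurableType disp} {R : realType}
    (m : {measure set T -> \bar R}) (f : T -> R) : Prop :=
  m.-integrable [set: T] (EFin \o f).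

Section real_integrals.
Context {disp : measure_display} {T : measurableType disp} {R : realType}.
Implicit Types (m : {measure set T -> \bar R}) (f g h : T -> R).

Definition bounded_measurable f : Prop :=
  measurable_fun [set: T] f /\ exists M : R, forall x, `|f x| <= M.

Local Notation bm := bounded_measurable.

Lemma bm_cst (a : R) : bm (fun=> a).
Proof. by split => //; exists `|a|. Qed.

Lemma bmN f : bm f -> bm (fun x => - f x).
Proof.
by move=> [mf [M fM]]; split; [exact: measurableT_comp|exists M => x; rewrite normrN].
Qed.

Lemma bmD f g : bm f -> bm g -> bm (fun x => f x + g x).
Proof.
move=> [mf [M fM]] [mg [N gN]]; split; first exact: measurable_funD.
by exists (M + N) => x; rewrite (le_trans (ler_normD _ _))// lerD.
Qed.

Lemma bmM f g : bm f -> bm g -> bm (fun x => f x * g x).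
Proof.
move=> [mf [M fM]] [mg [N gN]]; split; first exact: measurable_funM.
by exists (M * N) => x; rewrite normrM ler_pM.
Qed.

Lemma bm_min f g : bm f -> bm g -> bm (fun x => Num.min (f x) (g x)).
Proof.
move=> [mf [M fM]] [mg [N gN]]; split; first exact: measurable_minr.
exists (Num.max M N) => x; rewrite le_max.
by case: (leP (f x) (g x)) => _; rewrite ?fM ?gN ?orbT.
Qed.

Lemma bm_exp f : bm f -> bm (fun x => expR (f x)).
Proof.
move=> [mf [M fM]]; split; first exact: measurableT_comp.
exists (expR M) => x; rewrite ger0_norm ?expR_ge0// ler_expR.
exact: le_trans (ler_norm _) (fM x).
Qed.

Lemma bm_indic (A : set T) : measurable A -> bm (\1_A : T -> R).
Proof.
move=> mA; split; first exact: measurable_indic.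
by exists 1 => x; rewrite indicE ger0_norm// lern1; case: (_ \in _).
Qed.

Lemma bm_L1 m f : (m [set: T] < +oo)%E -> bm f -> L1 m f.
Proof.
move=> moo [mf [M fM]]; apply: measurable_bounded_integrable => //.
exists M; split; first exact: num_real.
by move=> x Mx y _ /=; rewrite (le_trans (fM y))// ltW.
Qed.

Lemma L1D m f g : L1 m f -> L1 m g -> L1 m (fun x => f x + g x).
Proof. by move=> fi gi; exact: (integrableD measurableT fi gi). Qed.

Lemma L1M m h f : bm h -> L1 m f -> L1 m (fun x => h x * f x).
Proof.
move=> [mh [M hM]] fi; apply: (integrableMr measurableT mh _ fi).
exists M; split; first exact: num_real.
by move=> x Mx y _ /=; rewrite (le_trans (hM y))// ltW.
Qed.

Lemma L1N m f : L1 m f -> L1 m (fun x => - f x).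
Proof.
move=> fi; have := L1M (bm_cst (-1)) fi.
by apply: eq_integrable => // x _ /=; rewrite mulN1r.
Qed.

Lemma L1_abs m f : L1 m f -> L1 m (fun x => `|f x|).
Proof. by move=> fi; apply: integrable_norm. Qed.

Lemma L1_le m f g : measurable_fun [set: T] f -> (forall x, `|f x| <= g x) ->
  L1 m g -> L1 m f.
Proof.
move=> mf fg gi; apply: le_integrable gi => //; first exact/measurable_EFinP.
by move=> x _ /=; rewrite lee_fin (le_trans (fg x))// ler_norm.
Qed.

Lemma L1_measurable m f : L1 m f -> measurable_fun [set: T] f.
Proof. by move=> /measurable_int /measurable_EFinP. Qed.


Lemma bmB f g : bm f -> bm g -> bm (fun x => f x - g x).
Proof. by move=> bf bg; apply: bmD => //; exact: bmN. Qed.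

Lemma L1B m f g : L1 m f -> L1 m g -> L1 m (fun x => f x - g x).
Proof. by move=> fi gi; apply: L1D => //; exact: L1N. Qed.

Lemma L1Z m a f : L1 m f -> L1 m (fun x => a * f x).
Proof. exact: L1M (bm_cst a). Qed.

Lemma bm_L1_prob (m : probability T R) f : bm f -> L1 m f.
Proof. by apply: bm_L1; rewrite [X in (X < _)%E](probability_setT m) ltry. Qed.

Lemma Rint_cst (m : probability T R) (r : R) : \int[m]_x r = r.
Proof. by rewrite Rintegral_cst// [X in fine X](probability_setT m) mulr1. Qed.

Lemma RintD m f g : L1 m f -> L1 m g ->
  \int[m]_x (f x + g x) = \int[m]_x f x + \int[m]_x g x.
Proof. by move=> *; rewrite RintegralD. Qed.

Lemma RintB m f g : L1 m f -> L1 m g ->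
  \int[m]_x (f x - g x) = \int[m]_x f x - \int[m]_x g x.
Proof. by move=> *; rewrite RintegralB. Qed.

Lemma RintZ m a f : L1 m f -> \int[m]_x (a * f x) = a * \int[m]_x f x.
Proof. by move=> *; rewrite RintegralZl. Qed.

Lemma Rint_le m f g : L1 m f -> L1 m g -> (forall x, f x <= g x) ->
  \int[m]_x f x <= \int[m]_x g x.
Proof. by move=> fi gi fg; apply: le_Rintegral. Qed.

Lemma Rint_eq m f g : f =1 g -> \int[m]_x f x = \int[m]_x g x.
Proof. by move=> fg; apply: eq_Rintegral => x _. Qed.

Lemma Rint_EFin m f : L1 m f -> (\int[m]_x (f x)%:E = (\int[m]_x f x)%:E)%E.
Proof. by move=> fi; rewrite /Rintegral fineK//; exact: integrable_fin_num. Qed.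

Lemma ge0_L1 m f : measurable_fun [set: T] f -> (forall x, 0 <= f x) ->
  (\int[m]_x (f x)%:E < +oo)%E -> L1 m f.
Proof.
move=> mf f0 foo; apply/integrableP; split; first exact/measurable_EFinP.
by under eq_integral do rewrite /= ger0_norm//.
Qed.

(** The function f agrees almost everywhere with the minimum of f and g. *)
Lemma Rint_ae_le m f g : L1 m f -> L1 m g -> {ae m, forall x, f x <= g x} ->
  \int[m]_x f x <= \int[m]_x g x.
Proof.
move=> fi gi fg.
rewrite (_ : Rintegral m _ f = \int[m]_x Num.min (f x) (g x)).
  apply: Rint_le => //; last by move=> x; rewrite ge_min lexx orbT.
  have fgi := L1D (L1_abs fi) (L1_abs gi).
  apply: (@L1_le m _ (fun x => `|f x| + `|g x|)) => [|x|]; last exact: fgi.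
    by apply: measurable_minr; [exact: L1_measurable fi|exact: L1_measurable gi].
  by case: (leP (f x) (g x)) => _; rewrite ?lerDl ?lerDr.
congr fine; apply: ae_eq_integral => //.
- by case/integrableP : fi.
- apply/measurable_EFinP; by apply: measurable_minr; [exact: L1_measurable fi|exact: L1_measurable gi].
- by apply: filterS fg => x fgx _; rewrite min_l.
Qed.

Lemma measurable_lt_set f g : measurable_fun [set: T] f ->
  measurable_fun [set: T] g -> measurable [set x | f x < g x].
Proof.
move=> mf mg; rewrite -[X in measurable X]setTI.
by apply: (measurable_fun_ltr mf mg measurableT (Y := [set true])).
Qed.

End real_integrals.

(** * Densities of sigma-finite measures *)

Local Notation bm := bounded_measurable.

Section densities.
Context {disp : measure_display} {T : measurableType disp} {R : realType}.
Implicit Types (m : probability T R) (nu : {measure set T -> \bar R}).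
Implicit Types (p q : T -> R).

Lemma is_density_dominates m nu p : is_density nu m p -> nu `<< m.
Proof.
move=> [mp p0 nuE]; apply/null_content_dominatesP => A mA mA0.
rewrite nuE//; rewrite -(@integral_abs_eq0 _ _ _ m A (EFin \o p)) //.
  by apply: eq_integral => x _ /=; rewrite ger0_norm.
by apply: measurable_funTS; exact/measurable_EFinP.
Qed.

Lemma is_density_L1 m nu p : is_density nu m p -> (nu [set: T] < +oo)%E -> L1 m p.
Proof. by move=> [mp p0 nuE] noo; apply: ge0_L1 => //; rewrite -nuE. Qed.

Lemma is_density_unique m nu p q : (nu [set: T] < +oo)%E ->
  is_density nu m p -> is_density nu m q -> {ae m, forall x, p x = q x}.
Proof.
move=> noo dp dq.
have : ae_eq m [set: T] (EFin \o p) (EFin \o q).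
  apply: integral_ae_eq => //.
  - exact: is_density_L1 dp noo.
  - by case: dq => mq _ _; exact/measurable_EFinP.
  - by move=> A _ mA; case: dp => _ _ <-//; case: dq => _ _ <-.
by apply: filterS => x /(_ I) [].
Qed.

(** Densities of a finite measure are unique almost everywhere, so the change of
    variables for one Radon-Nikodym derivative holds for all densities. *)
Lemma is_density_integral_ge0 m nu p (f : T -> \bar R) :
  (nu [set: T] < +oo)%E -> is_density nu m p ->
  measurable_fun [set: T] f -> (forall x, 0 <= f x)%E ->
  (\int[nu]_x f x = \int[m]_x (f x * (p x)%:E))%E.
Proof.
move=> noo dp mf f0.
pose nu' : {finite_measure set T -> \bar R} := mfrestr (@measurableT _ T) noo.
have nuE A : nu' A = nu A by rewrite /nu'/= /mfrestr /mrestr setIT.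
have nu'm : nu' `<< m.
  apply/null_content_dominatesP => A mA mA0; rewrite nuE.
  exact: (null_content_dominatesP _ _).1 (is_density_dominates dp) A mA mA0.
rewrite (_ : (\int[nu]_x f x = \int[nu']_x f x)%E); last first.
  by apply: eq_measure_integral => A mA _; rewrite -nuE.
rewrite -(Radon_Nikodym_SigmaFinite.change_of_variables nu'm)//.
set g := Radon_Nikodym_SigmaFinite.f nu' m.
have mg : measurable_fun [set: T] g.
  by have /integrableP[] := Radon_Nikodym_SigmaFinite.f_integrable nu'm.
have g0 x : (0 <= g x)%E by exact: Radon_Nikodym_SigmaFinite.f_ge0.
have mp : measurable_fun [set: T] (EFin \o p).
  by case: dp => mp _ _; exact/measurable_EFinP.
have p0 x : 0 <= p x by case: dp.
have gp : ae_eq m [set: T] g (EFin \o p).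
  apply: integral_ae_eq => //.
    exact: Radon_Nikodym_SigmaFinite.f_integrable.
  move=> A _ mA; rewrite -Radon_Nikodym_SigmaFinite.f_integral// nuE.
  by case: dp => _ _ ->.
apply: ge0_ae_eq_integral => //.
- exact: emeasurable_funM.
- exact: emeasurable_funM.
- by move=> x _; rewrite mule_ge0.
- by move=> x _; rewrite mule_ge0// lee_fin.
- by apply: filterS gp => x /(_ I) + _ => -> .
Qed.

(** Adding a bound of |f| to f reduces this to nonnegative functions. *)
Lemma is_density_bm m nu p f : (nu [set: T] < +oo)%E -> is_density nu m p ->
  bm f -> \int[nu]_x f x = \int[m]_x (f x * p x).
Proof.
move=> noo dp bf.
have pi := is_density_L1 dp noo.
have [mp p0 nuE] := dp.
have [mf [M fM]] := bf.
have cst_nu : L1 nu (fun=> M) by apply: bm_L1 => //; exact: bm_cst.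
have f_nu : L1 nu f by exact: bm_L1.
have key (g : T -> R) : measurable_fun [set: T] g -> (forall x, 0 <= g x) ->
    \int[nu]_x g x = \int[m]_x (g x * p x).
  move=> mg g0; congr fine; rewrite (is_density_integral_ge0 noo dp)//.
  exact/measurable_EFinP.
have M0 : 0 <= M by apply: le_trans (fM point).
have /= := key (fun x => f x + M).
rewrite RintD//.
under [X in _ -> _ -> _ = X]Rint_eq do rewrite mulrDl.
rewrite RintD; [|exact: L1M|exact/L1Z].
rewrite -(key (fun=> M))// => H; apply: (addIr (\int[nu]_x M)); apply: H.
  exact: measurable_funD.
by move=> x; rewrite -lerBlDr sub0r; have := fM x; rewrite ler_norml => /andP[].
Qed.

(** The Radon-Nikodym theorem for finite measures applies on each piece of a
    disjoint refinement of the cover C.  At every point at most one local density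
    contributes to the sum, which is therefore finite. *)
Lemma density_exists m nu (C : nat -> set T) :
  (forall k, measurable (C k) /\ (nu (C k) < +oo)%E) ->
  nu (~` \bigcup_k C k) = 0%E -> nu `<< m -> is_density nu m (density nu m).
Proof.
move=> mC nuC num; apply: xgetPex.
pose D := seqDU C.
have mD k : measurable (D k).
  by apply: measurableD => //; [exact: (mC k).1|apply: bigsetU_measurable => i _; exact: (mC i).1].
have Doo k : (nu (D k) < +oo)%E.
  apply: le_lt_trans (mC k).2; apply: le_measure; rewrite ?inE//.
    by have [] := mC k.
  exact: subDsetl.
have tD : trivIset setT D by exact: trivIset_seqDU.
have DC : \bigcup_k D k = \bigcup_k C k by rewrite [RHS]seqDU_bigcup_eq.
have /choice[g gP] : forall k, exists g : T -> \bar R,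
    [/\ forall x, (g x >= 0)%E, forall x, g x \is a fin_num,
    m.-integrable [set: T] g &
    forall A, measurable A -> nu (A `&` D k) = (\int[m]_(x in A) g x)%E].
  move=> k.
  have num' : mfrestr (mD k) (Doo k) `<< m.
    apply/null_content_dominatesP => A mA mA0 /=.
    rewrite /mfrestr /mrestr.
    apply: ((null_content_dominatesP _ _).1 num); first exact: measurableI.
    apply/eqP; rewrite eq_le measure_ge0 andbT -mA0 le_measure ?inE//.
    exact: measurableI.
  have [g [g0 gf gi gE]] := radon_nikodym_sigma_finite num'.
  by exists g.
pose h k x := (fine (g k x) * \1_(D k) x)%:E.
have h0 k x : (0 <= h k x)%E.
  by rewrite lee_fin mulr_ge0// fine_ge0//; have [] := gP k.
have mh k : measurable_fun [set: T] (h k).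
  apply/measurable_EFinP; apply: measurable_funM => //.
  have [_ _ /measurable_int mg _] := gP k.
  exact: measurableT_comp.
pose P x := (\sum_(k <oo) h k x)%E.
have mP : measurable_fun [set: T] P by exact: ge0_emeasurable_sum.
have Pfin x : P x \is a fin_num.
  have hD k : ~ D k x -> h k x = 0%E.
    by move=> Dkx; rewrite /h indicE memNset// mulr0.
  have [[k _ Dkx]|nD] := pselect ((\bigcup_k D k) x).
    rewrite /P (nneseriesD1 (n := k))// eseries0 ?adde0//.
    move=> i _ /= ik; apply: hD => Dix; move/eqP : ik; apply.
    by apply: (tD i k) => //; exists x.
  by rewrite /P eseries0// => i _ _; apply: hD => Di; apply: nD; exists i.
exists (fun x => fine (P x)); split.
- exact: measurableT_comp.
- by move=> x; apply/fine_ge0/nneseries_ge0.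
- move=> A mA.
  under eq_integral do rewrite fineK//.
  rewrite integral_nneseries//; last first.
    by move=> k; exact: measurable_funTS.
  have mUD : measurable (\bigcup_k D k) by exact: bigcup_measurable.
  have -> : nu A = nu (A `&` \bigcup_k D k).
    rewrite -{1}(setUIDK A (\bigcup_k D k)) measureU//; last 3 first.
    - exact: measurableI.
    - exact: measurableD.
    - by rewrite setDE setIACA setICr setI0.
    rewrite [X in (_ + X)%E](_ : _ = 0%E) ?adde0//.
    apply/eqP; rewrite eq_le measure_ge0 andbT -nuC -DC le_measure ?inE//.
    - exact: measurableD.
    - exact: measurableC.
  rewrite setI_bigcupr measure_bigcup//; last 2 first.
  - by move=> k _; exact: measurableI.
  - exact: trivIset_setIl.
  rewrite (@eq_eseriesl _ _ xpredT); last by move=> k; rewrite in_setT.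
  apply: eq_eseriesr => k _.
  have [g0 gf gi gE] := gP k.
  rewrite -[in LHS](setIid (D k)) setIA gE; last exact: measurableI.
  rewrite integral_mkcondr; apply: eq_integral => x _.
  rewrite /h patchE indicE; case: ifPn => xD; rewrite ?mulr1 ?mulr0//.
  by rewrite fineK.
Qed.

End densities.

(** * Total variation of weighted measures *)

Section sums.
Context {disp : measure_display} {T : measurableType disp} {R : realType}.

Lemma Rint_sum (m : {measure set T -> \bar R}) n (f : 'I_n -> T -> R) :
  (forall i, L1 m (f i)) ->
  \int[m]_x (\sum_(i < n) f i x) = \sum_(i < n) \int[m]_x f i x.
Proof.
move=> fi; elim: (index_enum _) => [|i s IH].
  by rewrite big_nil; under Rint_eq do rewrite big_nil; rewrite Rintegral_cst// mul0r.
rewrite big_cons -IH -RintD//; first by apply: Rint_eq => x; rewrite big_cons.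
elim: s {IH} => [|j s IH].
  rewrite (_ : (fun=> _) = fun=> 0); first exact: integrable0.
  by apply/funext => x; rewrite big_nil.
rewrite (_ : (fun=> _) = (fun x => f j x + \sum_(i <- s) f i x)); first exact: L1D.
by apply/funext => x; rewrite big_cons.
Qed.

Lemma sum_partition_indic n (F : 'I_n -> set T) (x : T) :
  trivIset [set: 'I_n] F -> \bigcup_(i in [set: 'I_n]) F i = [set: T] ->
  \sum_(i < n) \1_(F i) x = 1 :> R.
Proof.
move=> tF FT; have [i _ Fix] : (\bigcup_(i in [set: 'I_n]) F i) x by rewrite FT.
rewrite (bigD1 i)//= big1 ?addr0; first by rewrite indicE mem_set.
move=> j ji; rewrite indicE memNset// => Fjx; move/eqP: ji; apply.
by apply: tF => //; exists x.
Qed.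

End sums.

Section total_variation.
Context {d1 d2 : measure_display} {Z : measurableType d1} {T : measurableType d2}.
Context {R : realType}.
Implicit Types (alpha beta : set T -> \bar R).

(** The measure A |-> int_(pi^-1 A) k is additive, so its total mass bounds
    the sum of |alpha - beta| over any partition. *)
Lemma TV_le (rho : {measure set Z -> \bar R}) (pi : Z -> T) (k : Z -> R) alpha beta :
  measurable_fun [set: Z] pi -> L1 rho k ->
  (forall A, measurable A ->
    `|alpha A - beta A| <= (\int[rho]_z (\1_A (pi z) * k z))%:E)%E ->
  (TV alpha beta <= (\int[rho]_z k z)%:E)%E.
Proof.
move=> mpi ki ab; apply: ub_ereal_sup => _ [n [F [mF tF FT ->]]].
apply: le_trans (lee_sum _ (fun i _ => ab _ (mF i))) _.
rewrite sumEFin lee_fin -Rint_sum.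
  rewrite le_eqVlt; apply/orP; left; apply/eqP; apply: Rint_eq => z.
  by rewrite -mulr_suml sum_partition_indic// mul1r.
move=> i; apply: L1M => //; split.
  by apply: measurableT_comp mpi; exact: measurable_indic.
by exists 1 => z; have [_ [M]] := bm_indic (R := R) (mF i); rewrite indicE ger0_norm// lern1; case: (_ \in _).
Qed.

Lemma TV_ge alpha beta A : measurable A ->
  (`|alpha A - beta A| + `|alpha (~` A) - beta (~` A)| <= TV alpha beta)%E.
Proof.
move=> mA; apply: ereal_sup_ubound.
exists 2, (fun i => if i == ord0 then A else ~` A); split.
- by move=> i; case: ifP => _ //; exact: measurableC.
- apply/trivIsetP => i j _ _ ij; case: ifPn => i0; case: ifPn => j0.
  + by move: ij; rewrite (eqP i0) (eqP j0) eqxx.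
  + by rewrite setICr.
  + by rewrite setICl.
  + case: i i0 ij => [[|[|//]] ilt] // i0; case: j j0 => [[|[|//]] jlt] // j0.
- rewrite -subTset => x _; have [Ax|Ax] := pselect (A x).
    by exists ord0.
  by exists (lift ord0 ord0).
- by rewrite big_ord_recl big_ord1.
Qed.

End total_variation.

Section weighted_measures.
Context {disp : measure_display} {T : measurableType disp} {R : realType}.
Implicit Types (m : probability T R) (alpha beta : {measure set T -> \bar R}).
Variables (D : set T) (l : T -> R).
Hypotheses (mD : measurable D) (bl : bm (l \_ D)) (l0 : forall x, 0 <= (l \_ D) x).
Local Notation lam := (l \_ D).

Lemma weightedE (alpha : {measure set T -> \bar R}) A :
  (alpha [set: T] < +oo)%E -> measurable A ->
  (weighted D l alpha A = (\int[alpha]_x (\1_A x * lam x))%:E)%E.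
Proof.
move=> aoo mA; rewrite -Rint_EFin; last first.
  by apply: bm_L1 => //; apply: bmM => //; exact: bm_indic.
rewrite /weighted integral_mkcond; apply: eq_integral => x _.
rewrite !patchE indicE in_setI.
by case: (x \in A); case: (x \in D); rewrite /= ?mul1r ?mul0r ?mulr0.
Qed.

Lemma weighted_density m alpha a A :
  (alpha [set: T] < +oo)%E -> is_density alpha m a -> measurable A ->
  (weighted D l alpha A = (\int[m]_x (\1_A x * lam x * a x))%:E)%E.
Proof.
move=> aoo da mA; rewrite weightedE//; congr EFin; rewrite (is_density_bm aoo da)//.
by apply: bmM => //; exact: bm_indic.
Qed.

(** The comparison of the two measures on the set where b < a shows that this set
    is negligible. *)
Lemma setwise_le_density m alpha beta a b :
  (alpha [set: T] < +oo)%E -> (beta [set: T] < +oo)%E ->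
  is_density alpha m a -> is_density beta m b -> setwise_le alpha beta ->
  {ae m, forall x, a x <= b x}.
Proof.
move=> aoo boo da db ab.
have ai := is_density_L1 da aoo; have bi := is_density_L1 db boo.
have [ma a0 aE] := da; have [mb b0 bE] := db.
pose A := [set x | b x < a x].
have mA : measurable A by exact: measurable_lt_set.
have bA := bm_indic (R := R) mA.
pose h x := \1_A x * (a x - b x).
have hi : L1 m h by apply: L1M => //; exact: L1B.
have h0 x : 0 <= h x.
  rewrite /h indicE; case: (boolP (x \in A)); rewrite ?mul0r// mul1r inE /A/= => ?.
  by rewrite subr_ge0 ltW.
have : ae_eq m [set: T] (EFin \o h) (cst 0%E).
  apply/ae_eq_integral_abs => //; first exact: measurable_int hi.
  under eq_integral do rewrite /= ger0_norm//.
  rewrite Rint_EFin//; congr EFin; apply/eqP; rewrite eq_le Rintegral_ge0// andbT.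
  rewrite /h; under Rint_eq do rewrite mulrBr.
  rewrite RintB; [|exact: L1M|exact: L1M].
  rewrite subr_le0 -lee_fin -!Rint_EFin; [|exact: L1M|exact: L1M].
  have indE f : (\int[m]_x (\1_A x * f x)%:E = \int[m]_(x in A) (f x)%:E)%E.
    rewrite [RHS]integral_mkcond; apply: eq_integral => x _.
    by rewrite patchE indicE; case: (x \in A); rewrite ?mul1r ?mul0r.
  by rewrite !indE -aE// -bE//; exact: ab.
apply: filterS => x /(_ I) [] /=; rewrite /h indicE leNgt => hx; apply/negP => bax.
by move: hx; rewrite mem_set// mul1r => /eqP; rewrite subr_eq0 gt_eqF.
Qed.

(** The partition into the set where b < a and its complement is optimal. *)
Lemma TV_weighted_ge m alpha beta a b :
  (alpha [set: T] < +oo)%E -> (beta [set: T] < +oo)%E ->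
  is_density alpha m a -> is_density beta m b ->
  ((\int[m]_x (lam x * `|a x - b x|))%:E <= TV (weighted D l alpha) (weighted D l beta))%E.
Proof.
move=> aoo boo da db.
have ai := is_density_L1 da aoo; have bi := is_density_L1 db boo.
have [ma a0 aE] := da; have [mb b0 bE] := db.
pose A := [set x | b x < a x].
have mA : measurable A by exact: measurable_lt_set.
apply: le_trans (TV_ge _ _ mA).
have mA' := measurableC mA.
rewrite !(weighted_density aoo da)// !(weighted_density boo db)//.
have bAL B : measurable B -> bm (fun x => \1_B x * lam x).
  by move=> mB; apply: bmM => //; exact: bm_indic.
have ALi B f : measurable B -> L1 m f -> L1 m (fun x => \1_B x * lam x * f x).
  by move=> mB fi; apply: L1M => //; exact: bAL.
rewrite -!EFinB -RintB; [|exact: ALi..]; rewrite -RintB; [|exact: ALi..].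
rewrite -EFinD lee_fin.
set X := (X in _ <= `|X| + _); set Y := (X in _ <= _ + `|X|).
rewrite -(normrN Y); apply: le_trans (lerD (ler_norm X) (ler_norm (- Y))); rewrite {}/X {}/Y.
rewrite -RintB; [|by apply: L1B; exact: ALi..].
rewrite le_eqVlt; apply/orP; left; apply/eqP; apply: Rint_eq => x.
rewrite !indicE in_setC; case: (boolP (x \in A)) => xA /=.
  rewrite !mul1r !mul0r !subr0 -mulrBr gtr0_norm// subr_gt0.
  by move: xA; rewrite inE.
rewrite !mul1r !mul0r !subr0 sub0r -mulrBr -mulrN opprB ler0_norm ?opprB// subr_le0 leNgt.
by apply: contra xA; rewrite inE.
Qed.

End weighted_measures.

(** * Marginals, and lower bounds on the penalties *)

Section measure_of_density.
Context {disp : measure_display} {T : measurableType disp} {R : realType}.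
Variables (rho : {measure set T -> \bar R}) (p : T -> R).

(** The two proofs are arguments so that the measure structure can be attached
    to the function. *)
Definition density_measure (mp : measurable_fun [set: T] p)
  (p0 : forall x, 0 <= p x) (A : set T) : \bar R :=
  (\int[rho]_(x in A) (p x)%:E)%E.

Hypotheses (mp : measurable_fun [set: T] p) (p0 : forall x, 0 <= p x).
Local Notation nu := (density_measure mp p0).

Let nu0 : nu set0 = 0%E. Proof. exact: integral_set0. Qed.

Let nu_ge0 A : (0 <= nu A)%E.
Proof. by apply: integral_ge0 => x _; rewrite lee_fin. Qed.

Let nu_sigma_additive : semi_sigma_additive nu.
Proof.
apply: semi_sigma_additive_nng_induced => [|x]; last by rewrite lee_fin.
exact/measurable_EFinP.
Qed.

HB.instance Definition _ := isMeasure.Build _ _ _ nu nu0 nu_ge0 nu_sigma_additive.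

Lemma density_measureP : is_density nu rho p.
Proof. by []. Qed.

End measure_of_density.

Section marginals.
Context {d1 d2 : measure_display} {Z : measurableType d1} {T : measurableType d2}.
Context {R : realType}.
Variables (rho : probability Z R) (m : probability T R) (pi : Z -> T).
Hypotheses (mpi : measurable_fun [set: Z] pi)
  (rho_pi : forall A, measurable A -> rho (pi @^-1` A) = m A).

Lemma bm_comp (f : T -> R) : bm f -> bm (fun z => f (pi z)).
Proof.
by move=> [mf [M fM]]; split; [exact: measurableT_comp mpi|exists M].
Qed.

Lemma integral_marginal_ge0 (f : T -> \bar R) : measurable_fun [set: T] f ->
  (forall x, 0 <= f x)%E -> (\int[rho]_z f (pi z) = \int[m]_x f x)%E.
Proof.
move=> mf f0; transitivity (\int[pushforward rho pi]_x f x)%E.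
  by rewrite ge0_integral_pushforward// preimage_setT.
by apply: (@eq_measure_integral _ _ _ _ _ (pushforward rho pi)) => A mA _; exact: rho_pi.
Qed.

Lemma L1_comp (f : T -> R) : L1 m f -> L1 rho (fun z => f (pi z)).
Proof.
move=> /integrableP[mf foo]; apply/integrableP; split.
  exact: measurableT_comp mf mpi.
rewrite (integral_marginal_ge0 (f := fun x => `|(f x)%:E|%E))//.
exact: measurableT_comp.
Qed.

Lemma Rint_comp (f : T -> R) : L1 m f -> \int[rho]_z f (pi z) = \int[m]_x f x.
Proof.
move=> fi; congr fine; transitivity (\int[pushforward rho pi]_x (f x)%:E)%E.
  rewrite integral_pushforward//; first by case/integrableP : fi.
  by rewrite preimage_setT; exact: L1_comp.
by apply: (@eq_measure_integral _ _ _ _ _ (pushforward rho pi)) => A mA _; exact: rho_pi.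
Qed.

(** The measure structure of a pushforward depends on the measurability of pi,
    which canonical inference cannot provide. *)
Definition marginal (gamma : {measure set Z -> \bar R}) : {measure set T -> \bar R}.
Proof.
pose nu : {measure set T -> \bar R} := pushforward gamma pi.
exact: (nu mpi).
Defined.

Lemma marginalE gamma : marginal gamma = pushforward gamma pi :> (set T -> \bar R).
Proof. by []. Qed.

Lemma marginal_lty (gamma : {measure set Z -> \bar R}) :
  (gamma [set: Z] < +oo)%E -> (marginal gamma [set: T] < +oo)%E.
Proof. by rewrite marginalE /pushforward preimage_setT. Qed.

Lemma Rint_pushforward (gamma : {measure set Z -> \bar R}) (p : Z -> R) (h : T -> R) :
  (gamma [set: Z] < +oo)%E -> is_density gamma rho p -> bm h ->
  \int[marginal gamma]_x h x = \int[rho]_z (h (pi z) * p z).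
Proof.
move=> goo dp bh; rewrite -(is_density_bm goo dp (bm_comp bh)).
have [mh _] := bh; congr fine; rewrite marginalE integral_pushforward//.
  exact/measurable_EFinP.
by rewrite preimage_setT; apply: bm_L1 => //; exact: bm_comp.
Qed.

(** The function u is the conditional expectation of p given pi.  It comes from
    the Radon-Nikodym theorem rather than from integration along fibres, so that
    both factors of a product are treated alike. *)
Lemma marginal_density (gamma : {measure set Z -> \bar R}) (p : Z -> R) :
  (gamma [set: Z] < +oo)%E -> is_density gamma rho p ->
  exists u, is_density (pushforward gamma pi) m u /\
    forall h, bm h -> \int[rho]_z (h (pi z) * p z) = \int[m]_x (h x * u x).
Proof.
move=> goo dp.
pose nu := marginal gamma; have nuoo : (nu [set: T] < +oo)%E by exact: marginal_lty.
have num : nu `<< m.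
  apply/null_content_dominatesP => A mA mA0.
  apply: ((null_content_dominatesP _ _).1 (is_density_dominates dp)).
    by rewrite -[X in measurable X]setTI; exact: mpi.
  by rewrite -mA0; exact: rho_pi.
have du : is_density nu m (density nu m).
  apply: (@density_exists _ _ _ _ _ (fun=> [set: T])) => //.
  by rewrite bigcup_const// setCT measure0.
exists (density nu m); split => // h bh.
by rewrite -(is_density_bm nuoo du bh) -(Rint_pushforward goo dp bh).
Qed.

End marginals.

Section penalties.
Context {disp : measure_display} {T : measurableType disp} {R : realType}.
Variables (D : set T) (l : T -> R).
Hypotheses (mD : measurable D) (bl : bm (l \_ D)) (l0 : forall x, 0 <= (l \_ D) x).
Local Notation lam := (l \_ D).
Implicit Types (m : probability T R) (alpha beta : {measure set T -> \bar R}).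

(** The measure beta does not charge the complement of D, where the extended
    weight vanishes. *)
Lemma dual_integralE m beta b phi : (beta [set: T] < +oo)%E ->
  beta (~` D) = 0%E -> is_density beta m b -> bm phi ->
  (\int[beta]_(x in D) (Num.min (phi x) (l x))%:E =
   (\int[m]_x (Num.min (phi x) (lam x) * b x))%:E)%E.
Proof.
move=> boo bD db bphi.
have bmin := bm_min bphi bl.
rewrite -(is_density_bm boo db bmin) -Rint_EFin; last exact: bm_L1.
rewrite [RHS](negligible_integral (N := ~` D))//; last 2 first.
- exact: measurableC.
- exact: bm_L1.
rewrite setTD setCK; apply: eq_integral => x xD.
by rewrite patchE xD.
Qed.

Lemma TV_ge0 (alpha beta : set T -> \bar R) : (0 <= TV alpha beta)%E.
Proof.
apply: le_trans (TV_ge alpha beta measurableT).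
by rewrite adde_ge0.
Qed.

(** Let b and a be nonnegative.  Then min (phi, lam) b - phi a <= lam |a - b| holds
    as soon as - lam <= phi or a <= b.  The first alternative is the constraint that
    comes with the TV penalty, the second one is a consequence of alpha <= beta. *)
Lemma penalty_ge t m alpha beta a b phi :
  (alpha [set: T] < +oo)%E -> (beta [set: T] < +oo)%E ->
  is_density alpha m a -> is_density beta m b -> bm phi ->
  (t = PenTV -> {ae m, forall x, - lam x <= phi x}) ->
  ((\int[m]_x (Num.min (phi x) (lam x) * b x) - \int[m]_x (phi x * a x))%:E
    <= primal_penalty t D l alpha beta)%E.
Proof.
move=> aoo boo da db bphi tphi.
have ai := is_density_L1 da aoo; have bi := is_density_L1 db boo.
have [ma a0 _] := da; have [mb b0 _] := db.
have bmin := bm_min bphi bl.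
have bphii := L1M bmin bi; have aphii := L1M bphi ai.
have labi : L1 m (fun x => lam x * `|a x - b x|).
  by apply: L1M => //; apply: L1_abs; exact: L1B.
rewrite -RintB//.
have bound : {ae m, forall x, - lam x <= phi x \/ a x <= b x} ->
    \int[m]_x (Num.min (phi x) (lam x) * b x - phi x * a x)
    <= \int[m]_x (lam x * `|a x - b x|).
  move=> H; apply: Rint_ae_le => //; first exact: L1B.
  apply: filterS H => x H.
  have := a0 x; have := b0 x; have := l0 x.
  move: (a x) (b x) (lam x) (phi x) H => A B C F H C0 B0 A0.
  case: (leP A B) => AB; case: (leP F C) => FC.
  - rewrite ler0_norm ?subr_le0//; nra.
  - rewrite ler0_norm ?subr_le0//; nra.
  - rewrite gtr0_norm ?subr_gt0//.
    have {}H : - C <= F by case: H => //; lra.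
    nra.
  - rewrite gtr0_norm ?subr_gt0//.
    nra.
case: t tphi => [/(_ erefl) H|_] /=.
  apply: le_trans (TV_weighted_ge bl aoo boo da db); rewrite lee_fin.
  by apply: bound; apply: filterS H => x; left.
rewrite /PTVbar /iota_ind; case: asboolP => ab; last first.
  rewrite addey ?leey// /PTV; case: ifP => // _.
  by rewrite gt_eqF// (lt_le_trans _ (TV_ge0 _ _)).
rewrite adde0 /PTV; case: ifP => [_|]; last by rewrite leey.
apply: le_trans (TV_weighted_ge bl boo aoo db da); rewrite lee_fin.
under [leRHS]Rint_eq do rewrite distrC.
apply: bound; apply: filterS (setwise_le_density aoo boo da db ab) => x.
by right.
Qed.

End penalties.

(** * Upper bounds on the penalties *)

Section penalty_upper.
Context {d1 d2 : measure_display} {Z : measurableType d1} {T : measurableType d2}.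
Context {R : realType}.
Variables (rho : probability Z R) (m : probability T R) (pi : Z -> T).
Hypotheses (mpi : measurable_fun [set: Z] pi)
  (rho_pi : forall A, measurable A -> rho (pi @^-1` A) = m A).
Variables (D : set T) (l : T -> R).
Hypotheses (bl : bm (l \_ D)) (l0 : forall x, 0 <= (l \_ D) x).
Local Notation lam := (l \_ D).
Variables (beta : {measure set T -> \bar R}) (b : T -> R).
Hypotheses (boo : (beta [set: T] < +oo)%E) (db : is_density beta m b).
Variables (gamma : {measure set Z -> \bar R}) (p' : Z -> R).
Hypotheses (goo : (gamma [set: Z] < +oo)%E) (dp' : is_density gamma rho p').

Let bi : L1 m b. Proof. exact: is_density_L1 db boo. Qed.
Let p'i : L1 rho p'. Proof. exact: is_density_L1 dp' goo. Qed.

(** Decreasing the plan density from p to p' moves the weighted marginal by at most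
    the weighted mass removed. *)
Lemma penalty_TV_le (p : Z -> R) (u : T -> R) :
  L1 rho p -> (forall z, p' z <= p z) -> L1 m u ->
  (forall h, bm h -> \int[rho]_z (h (pi z) * p z) = \int[m]_x (h x * u x)) ->
  (primal_penalty PenTV D l (pushforward gamma pi) beta <=
  (\int[m]_x (lam x * `|b x - u x|) + \int[rho]_z (lam (pi z) * (p z - p' z)))%:E)%E.
Proof.
move=> ip p'p ui hu.
have Lpi := bm_comp mpi bl.
have qi : L1 rho (fun z => p z - p' z) by exact: L1B.
have bui : L1 m (fun x => `|b x - u x|) by apply: L1_abs; exact: L1B.
have Lbui : L1 m (fun x => lam x * `|b x - u x|) by exact: L1M.
have Lbui' := L1_comp mpi rho_pi Lbui.
have Lqi : L1 rho (fun z => lam (pi z) * (p z - p' z)) by exact: L1M.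
rewrite -(Rint_comp mpi rho_pi Lbui) -RintD//.
have aoo := marginal_lty mpi goo.
apply: (@TV_le _ _ _ _ _ rho pi) => //; first exact: L1D.
move=> A mA.
have bA := bm_indic (R := R) mA.
have bAL : bm (fun x => \1_A x * lam x) by exact: bmM.
have bApi := bm_comp mpi bA.
have bALpi := bm_comp mpi bAL.
rewrite (weightedE bl aoo mA).
rewrite (weighted_density bl boo db mA).
rewrite (Rint_pushforward mpi goo dp' bAL) -EFinB abse_EFin lee_fin.
rewrite (_ : \int[rho]_z _ = \int[m]_x (\1_A x * lam x * u x)
   - \int[rho]_z (\1_A (pi z) * lam (pi z) * (p z - p' z))); last first.
  rewrite -hu// -RintB; [|exact: L1M..].
  by apply: Rint_eq => z; ring.
have Ai (f : T -> R) : L1 m f -> L1 m (fun x => \1_A x * lam x * f x) by move=> fi; exact: L1M.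
rewrite addrAC -RintB; [|exact: Ai..].
apply: le_trans (ler_normB _ _) _.
have H1 : L1 rho (fun z => \1_A (pi z) * lam (pi z) * `|b (pi z) - u (pi z)|).
  exact: (L1_comp mpi rho_pi (Ai _ bui)).
have H2 : L1 rho (fun z => \1_A (pi z) * lam (pi z) * (p z - p' z)) by exact: L1M.
under [leRHS]Rint_eq do rewrite mulrDr !mulrA.
rewrite (RintD H1 H2) (Rint_comp mpi rho_pi (Ai _ bui)).
have AL0 x : 0 <= \1_A x * lam x by rewrite mulr_ge0// indicE.
apply: lerD; last first.
  rewrite ger0_norm//; apply: Rintegral_ge0 => z _.
  by rewrite mulr_ge0// subr_ge0.
apply: le_trans (le_normr_Rintegral _ _) _ => //.
  by apply: L1B; exact: Ai.
rewrite le_eqVlt; apply/orP; left; apply/eqP; apply: Rint_eq => x.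
by rewrite -mulrBr normrM (ger0_norm (AL0 x)) distrC.
Qed.

(** Multiplying p by theta brings its marginal below beta, and this persists under
    a further decrease to p'; the variation is then a difference of masses. *)
Lemma penalty_PTV_le (p : Z -> R) (u theta : T -> R) :
  L1 rho p -> L1 m u -> bm theta ->
  (forall z, p' z <= theta (pi z) * p z) ->
  (forall x, theta x * u x <= b x) ->
  (forall h, bm h -> \int[rho]_z (h (pi z) * p z) = \int[m]_x (h x * u x)) ->
  (primal_penalty PenPTVbar D l (pushforward gamma pi) beta <=
  (\int[m]_x (lam x * b x) - \int[rho]_z (lam (pi z) * p' z))%:E)%E.
Proof.
move=> ip ui bt p't tub hu.
pose alpha := marginal mpi gamma; have aoo := marginal_lty mpi goo.
have ab : setwise_le alpha beta.
  move=> A mA.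
  have bA := bm_indic (R := R) mA.
  rewrite -[A]setIT -!integral_indic//.
  have E (f : T -> R) (nu : {measure set T -> \bar R}) : (nu [set: T] < +oo)%E -> bm f ->
      (\int[nu]_x (f x)%:E = (\int[nu]_x f x)%:E)%E.
    by move=> noo bf; rewrite Rint_EFin//; exact: bm_L1.
  rewrite (E _ _ aoo bA) (E _ _ boo bA) lee_fin.
  rewrite (Rint_pushforward mpi goo dp' bA) (is_density_bm boo db bA).
  have A0 x : 0 <= \1_A x :> R by rewrite indicE.
  have bAt : bm (fun x => \1_A x * theta x) by exact: bmM.
  have bApi := bm_comp mpi bA; have bAtpi := bm_comp mpi bAt.
  apply: (@le_trans _ _ (\int[rho]_z (\1_A (pi z) * theta (pi z) * p z))).
    apply: Rint_le; [exact: L1M|exact: L1M|move=> z].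
    by rewrite -mulrA ler_wpM2l.
  rewrite (hu _ bAt); apply: Rint_le; [exact: L1M|exact: L1M|move=> x].
  by rewrite -mulrA ler_wpM2l.
have [a [da ha]] := marginal_density mpi rho_pi goo dp'.
have ai : L1 m a := is_density_L1 da aoo.
have abae := setwise_le_density aoo boo da db ab.
have wab : setwise_le (weighted D l alpha) (weighted D l beta).
  move=> A mA; rewrite (weighted_density bl aoo da mA) (weighted_density bl boo db mA).
  rewrite lee_fin.
  have bAL : bm (fun x => \1_A x * lam x) by apply: bmM => //; exact: bm_indic.
  apply: Rint_ae_le; [exact: L1M|exact: L1M|].
  by apply: filterS abae => x abx; rewrite ler_wpM2l// mulr_ge0// indicE.
rewrite /= /PTVbar /iota_ind (asboolT ab) adde0 /PTV (asboolT wab).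
rewrite (ha _ bl) -RintB; [|exact: L1M..].
under Rint_eq do rewrite -mulrBr.
apply: (@TV_le _ _ _ _ _ m id) => //.
  by apply: L1M => //; exact: L1B.
move=> A mA.
rewrite (weighted_density bl aoo da mA) (weighted_density bl boo db mA).
have bAL : bm (fun x => \1_A x * lam x) by apply: bmM => //; exact: bm_indic.
rewrite -EFinB abse_EFin lee_fin -RintB; [|exact: L1M..].
rewrite ger0_norm.
  by rewrite le_eqVlt; apply/orP; left; apply/eqP; apply: Rint_eq => x; ring.
rewrite RintB; [|exact: L1M..].
rewrite subr_ge0; apply: Rint_ae_le; [exact: L1M|exact: L1M|].
by apply: filterS abae => x abx; rewrite ler_wpM2l// mulr_ge0// indicE.
Qed.

End penalty_upper.

(** * Repairing one marginal of a Gibbs plan *)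

Section marginal_repair.
Context {d1 d2 : measure_display} {Z : measurableType d1} {T : measurableType d2}.
Context {R : realType}.
Variables (rho : probability Z R) (m : probability T R) (pi : Z -> T).
Hypotheses (mpi : measurable_fun [set: Z] pi)
  (rho_pi : forall A, measurable A -> rho (pi @^-1` A) = m A).
Variables (D : set T) (l : T -> R).
Hypotheses (bl : bm (l \_ D)) (l0 : forall x, 0 <= (l \_ D) x).
Local Notation lam := (l \_ D).
Variables (beta : {measure set T -> \bar R}) (f : T -> R).
Hypotheses (boo : (beta [set: T] < +oo)%E) (df : is_density beta m f).

(** For the TV penalty this is the constraint of the dual problem, for the other
    penalty a cut at level - M which is sent to minus infinity in the end. *)
Definition box_floor (t : penalty) (M : R) (x : T) : R :=
  match t with PenTV => - lam x | PenPTVbar => - M end.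

Definition in_box t M (phi : T -> R) : Prop :=
  bm phi /\ forall x, box_floor t M x <= phi x <= lam x.

Lemma box_floor_le t M x : 0 <= M -> box_floor t M x <= lam x.
Proof. by move=> M0; have := l0 x; case: t => /=; lra. Qed.

Lemma bm_box_floor t M : bm (box_floor t M).
Proof. by case: t; [exact: bmN|exact: bm_cst]. Qed.

(** Let u be the marginal of p.  The potential chi equals lam where u < f and the
    floor of the box elsewhere; it maximises chi (f - u), so that G, the integral of
    (chi - phi) (f - u), is the first-order error of phi and is nonnegative.
    The factor theta is 1 for the TV penalty, and min (1, f / u) for the other one.

    In the latter case the mass removed is the integral of the positive part of
    u - f.  Where phi >= - M / 2, the integrand of G is at least M / 2 times that
    positive part; elsewhere the positive part is at most u.

    In the last inequality p' is any further decrease of theta p.  It costs at most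
    lam - phi per unit of mass in the difference between the penalty and the
    linear terms. *)
Lemma one_sided_repair t (M : R) (p : Z -> R) (phi : T -> R) : 0 < M ->
  L1 rho p -> (forall z, 0 <= p z) -> in_box t M phi ->
  exists theta chi : T -> R, [/\ bm theta, forall x, 0 <= theta x <= 1,
    in_box t M chi &
    let G := \int[m]_x ((chi x - phi x) * f x)
             - \int[rho]_z ((chi (pi z) - phi (pi z)) * p z) in
    \int[rho]_z ((1 - theta (pi z)) * p z) <=
      2 / M * G + \int[rho]_z (\1_[set x | phi x < - M / 2] (pi z) * p z) /\
    forall (gamma : {measure set Z -> \bar R}) (p' : Z -> R),
      (gamma [set: Z] < +oo)%E -> is_density gamma rho p' ->
      (forall z, p' z <= theta (pi z) * p z) ->
      (primal_penalty t D l (pushforward gamma pi) beta <=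
       (\int[m]_x (phi x * f x) - \int[rho]_z (phi (pi z) * p' z) + G
        + \int[rho]_z ((lam (pi z) - phi (pi z)) * (theta (pi z) * p z - p' z)))%:E)%E].
Proof.
move=> M0 ip p0 [bphi phi_box].
have t_cases : t = PenTV \/ t = PenPTVbar by case: (t); [left|right].
have fi := is_density_L1 df boo; have [mf f0 _] := df.
have mp := L1_measurable ip.
pose gamma0 : {measure set Z -> \bar R} := density_measure rho mp p0.
have g0oo : (gamma0 [set: Z] < +oo)%E.
  by rewrite /gamma0/= /density_measure Rint_EFin// ltry.
have [u [[mu u0 uE] hu]] := marginal_density mpi rho_pi g0oo (density_measureP rho mp p0).
have ui : L1 m u by exact: is_density_L1 (And3 mu u0 uE) (marginal_lty mpi g0oo).
(* Ties u = f may go to either side: the integrand of G vanishes there. *)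
pose A := [set x | u x < f x].
have mA : measurable A by exact: measurable_lt_set.
have bA := bm_indic (R := R) mA.
have ba := bm_box_floor t M.
pose chi x := box_floor t M x + \1_A x * (lam x - box_floor t M x).
have bchi : bm chi by apply: bmD => //; apply: bmM => //; exact: bmB.
have chiA x : u x < f x -> chi x = lam x.
  by move=> ufx; rewrite /chi indicE mem_set// mul1r addrC subrK.
have chiNA x : f x <= u x -> chi x = box_floor t M x.
  by move=> fux; rewrite /chi indicE memNset ?mul0r ?addr0// /A/= ltNge fux.
(* Where u = 0 the power convention gives theta = 0, which keeps theta u = min (u, f). *)
pose theta x := if t is PenPTVbar then Num.min 1 (f x * (u x) `^ (-1)) else 1.
have theta01 x : 0 <= theta x <= 1.
  rewrite /theta; case: (t); rewrite ?ler01 ?lexx// ge_min lexx andbT le_min ler01/=.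
  by rewrite mulr_ge0// powR_ge0.
have btheta : bm theta.
  split; last by exists 1 => x; have /andP[t0 t1] := theta01 x; rewrite ger0_norm.
  rewrite /theta; case: (t) => //; apply: measurable_minr => //.
  apply: measurable_funM => //; apply: (measurableT_comp (measurable_powR (-1)) mu).
have thetau x : t = PenPTVbar -> theta x * u x = Num.min (u x) (f x).
  move=> tE; rewrite /theta tE powR_inv1//.
  have [->|un0] := eqVneq (u x) 0; first by rewrite mulr0 min_l.
  have u_gt0 : 0 < u x by rewrite lt_def un0 u0.
  by rewrite minr_pMl ?ltW// mul1r divfK.
have bB : bm (\1_[set x | phi x < - M / 2] : T -> R).
  by apply: bm_indic; apply: measurable_lt_set => //; case: bphi.
have chiphi := bmB bchi bphi.
have G_E : \int[m]_x ((chi x - phi x) * f x)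
   - \int[rho]_z ((chi (pi z) - phi (pi z)) * p z) =
   \int[m]_x ((chi x - phi x) * (f x - u x)).
  rewrite (hu _ chiphi) -RintB; [|exact: L1M..].
  by apply: Rint_eq => x; ring.
have fui : L1 m (fun x => f x - u x) by exact: L1B.
have Gi : L1 m (fun x => (chi x - phi x) * (f x - u x)) by exact: L1M.
have G0 x : 0 <= (chi x - phi x) * (f x - u x).
  have /andP[p1 p2] := phi_box x.
  case: (ltP (u x) (f x)) => [ufx|fux]; first by rewrite chiA// mulr_ge0 ?subr_ge0// ltW.
  by rewrite chiNA// mulr_le0// subr_le0.
exists theta, chi; split => //.
  split => // x; case: (ltP (u x) (f x)) => [ufx|fux].
    by rewrite chiA// lexx andbT box_floor_le// ltW.
  by rewrite chiNA// lexx box_floor_le// ltW.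
rewrite G_E; split.
  have b1t : bm (fun x => 1 - theta x) by apply: bmB => //; exact: bm_cst.
  rewrite (hu _ b1t) (hu _ bB) -RintZ// -RintD; [|exact: L1Z|exact: L1M].
  apply: Rint_le; [exact: L1M|by apply: L1D; [exact: L1Z|exact: L1M]|move=> x].
  have i0 : 0 <= \1_[set x | phi x < - M / 2] x * u x by rewrite mulr_ge0// indicE.
  have M20 : 0 <= 2 / M by rewrite divr_ge0// ltW.
  have r0 := mulr_ge0 M20 (G0 x).
  have [tE|tE] := t_cases; last first.
    rewrite mulrBl mul1r thetau//.
    case: (ltP (u x) (f x)) => [ufx|fux]; first by rewrite subrr addr_ge0.
    have := r0; rewrite (chiNA _ fux) tE /=.
    have [phiM|phiM] := ltP (phi x) (- M / 2).
      rewrite indicE mem_set// mul1r => r0'; apply: (@le_trans _ _ (u x)).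
        by rewrite gerBl.
      by rewrite lerDr.
    rewrite indicE memNset ?mul0r ?addr0 => [_|]; last by rewrite /= ltNge phiM.
    rewrite (mulrAC 2) ler_pdivlMr//.
    have : 0 <= (phi x - - M / 2) * (u x - f x) by rewrite mulr_ge0 ?subr_ge0.
    lra.
  by rewrite /theta tE subrr mul0r addr_ge0.
move=> gamma p' goo dp' p't.
have p'i := is_density_L1 dp' goo.
have bphipi := bm_comp mpi bphi; have blpi := bm_comp mpi bl.
have bthpi := bm_comp mpi btheta.
have bLp := bmB bl bphi.
rewrite (_ : \int[rho]_z ((lam (pi z) - phi (pi z)) * (theta (pi z) * p z - p' z)) =
   \int[m]_x ((lam x - phi x) * theta x * u x)
   - \int[rho]_z (lam (pi z) * p' z) + \int[rho]_z (phi (pi z) * p' z)); last first.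
  rewrite -(hu (fun x => (lam x - phi x) * theta x)); last exact: bmM.
  rewrite -RintB; [|apply: L1M => //; apply: bmM => //; exact: bmB|exact: L1M].
  rewrite -RintD; [|apply: L1B; [apply: L1M => //; apply: bmM => //; exact: bmB|exact: L1M]|exact: L1M].
  by apply: Rint_eq => z; ring.
have [tE|tE] := t_cases.
  rewrite tE; have pp z : p' z <= p z by have := p't z; rewrite /theta tE mul1r.
  apply: le_trans (penalty_TV_le mpi rho_pi bl l0 boo df goo dp' ip pp ui hu) _.
  rewrite lee_fin.
  have bLt : bm (fun x => (lam x - phi x) * theta x) by exact: bmM.
  have Labs : L1 m (fun x => lam x * `|f x - u x|) by apply: L1M => //; exact: L1_abs.
  have pp'i : L1 rho (fun z => p z - p' z) by exact: L1B.
  rewrite (_ : \int[m]_x (lam x * `|f x - u x|) = \int[m]_x (phi x * f x)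
      - \int[m]_x (phi x * u x) + \int[m]_x ((chi x - phi x) * (f x - u x))); last first.
    rewrite -RintB; [|exact: L1M..]; rewrite -RintD//; last by apply: L1B; exact: L1M.
    apply: Rint_eq => x; case: (ltP (u x) (f x)) => [ufx|fux].
      by rewrite chiA// gtr0_norm ?subr_gt0//; ring.
    by rewrite chiNA// ler0_norm ?subr_le0// tE /=; ring.
  rewrite (_ : \int[rho]_z (lam (pi z) * (p z - p' z)) =
      \int[m]_x (lam x * u x) - \int[rho]_z (lam (pi z) * p' z)); last first.
    rewrite -(hu _ bl) -RintB; [|exact: L1M..].
    by apply: Rint_eq => z; rewrite mulrBr.
  rewrite (_ : \int[m]_x ((lam x - phi x) * theta x * u x) =
      \int[m]_x (lam x * u x) - \int[m]_x (phi x * u x)); last first.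
    rewrite -RintB; [|exact: L1M..].
    by apply: Rint_eq => x; rewrite /theta tE; ring.
  lra.
rewrite tE; have thub x : theta x * u x <= f x by rewrite thetau// ge_min lexx orbT.
apply: le_trans (penalty_PTV_le mpi rho_pi bl l0 boo df goo dp' ip ui btheta p't thub hu) _.
rewrite lee_fin.
have bLt : bm (fun x => (lam x - phi x) * theta x) by exact: bmM.
have : \int[m]_x (lam x * f x) <= \int[m]_x (phi x * f x)
    + \int[m]_x ((chi x - phi x) * (f x - u x))
    + \int[m]_x ((lam x - phi x) * theta x * u x).
  have phifi : L1 m (fun x => phi x * f x) by exact: L1M.
  rewrite -RintD// -RintD; [|exact: L1D|exact: L1M].
  apply: Rint_le; [exact: L1M|by apply: L1D; [exact: L1D|exact: L1M]|move=> x].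
  rewrite -mulrA thetau//; case: (ltP (u x) (f x)) => [ufx|fux].
    by rewrite chiA// le_eqVlt; apply/orP; left; apply/eqP; ring.
  rewrite chiNA// tE /=.
  have : 0 <= (phi x + M) * (u x - f x).
    rewrite mulr_ge0 ?subr_ge0//.
    by have := phi_box x; rewrite tE /= => /andP[+ _]; rewrite -subr_ge0 opprK.
  lra.
lra.
Qed.
End marginal_repair.

(** * Near-maximisers of the dual over a box of potentials *)

Section elementary.
Context {R : realType}.

Lemma expR_le_quadratic (x : R) : `|x| <= 1 / 2 -> expR x <= 1 + x + 2 * x ^+ 2.
Proof.
rewrite ler_norml => /andP[x1 x2].
have e1 : 1 - x <= expR (- x) by have := expR_ge1Dx (- x).
have x0 : 0 < 1 - x by lra.
rewrite -[x in expR x]opprK expRN.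
apply: (@le_trans _ _ (1 - x)^-1); first by rewrite lef_pV2 ?posrE ?expR_gt0.
rewrite -[leLHS]mul1r ler_pdivrMr//.
have : 0 <= x ^+ 2 * (1 - 2 * x) by rewrite mulr_ge0 ?sqr_ge0//; lra.
lra.
Qed.

Lemma expRN_le_inv (y : R) : 0 < y -> expR (- y) <= y^-1.
Proof.
move=> y0; rewrite expRN lef_pV2 ?posrE ?expR_gt0//.
by have := expR_ge1Dx y; lra.
Qed.

Lemma mulr_expRN_le (s eps : R) : 0 < eps -> 0 < s ->
  s * expR (- (s / eps)) <= 4 * eps ^+ 2 / s.
Proof.
move=> e0 s0; rewrite ler_pdivlMr//.
have y0 : 0 < s / eps / 2 by rewrite !divr_gt0.
have q := expRN_le_inv y0.
have -> : expR (- (s / eps)) = expR (- (s / eps / 2)) ^+ 2.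
  by rewrite expr2 -expRD; congr expR; field; rewrite gt_eqF.
have {q} : expR (- (s / eps / 2)) ^+ 2 <= (s / eps / 2)^-1 ^+ 2.
  by rewrite ler_pXn2r ?nnegrE ?expR_ge0 ?invr_ge0 ?(ltW y0).
rewrite -(ler_pM2l (exprn_gt0 2 s0)).
have -> : s ^+ 2 * (s / eps / 2)^-1 ^+ 2 = 4 * eps ^+ 2.
  by field; rewrite !gt_eqF.
by move=> sE; rewrite mulrAC -expr2.
Qed.

End elementary.

Section first_order.
Context {d1 d2 d3 : measure_display} {X : measurableType d1} {Y : measurableType d2}.
Context {Z : measurableType d3} {R : realType}.
Variables (dx : probability X R) (dy : probability Y R) (rho : probability Z R).
Variables (pi1 : Z -> X) (pi2 : Z -> Y).
Hypotheses (mpi1 : measurable_fun [set: Z] pi1)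
  (rho_pi1 : forall A, measurable A -> rho (pi1 @^-1` A) = dx A).
Hypotheses (mpi2 : measurable_fun [set: Z] pi2)
  (rho_pi2 : forall A, measurable A -> rho (pi2 @^-1` A) = dy A).
Variables (D1 : set X) (l1 : X -> R) (D2 : set Y) (l2 : Y -> R).
Hypotheses (bl1 : bm (l1 \_ D1)) (l10 : forall x, 0 <= (l1 \_ D1) x).
Hypotheses (bl2 : bm (l2 \_ D2)) (l20 : forall x, 0 <= (l2 \_ D2) x).
Local Notation lam1 := (l1 \_ D1).
Local Notation lam2 := (l2 \_ D2).
Variables (f : X -> R) (g : Y -> R) (fi : L1 dx f) (gi : L1 dy g)
  (f0 : forall x, 0 <= f x) (g0 : forall y, 0 <= g y).
Variables (eps : R) (eps0 : 0 < eps) (K : Z -> R) (bK : bm K)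
  (K01 : forall z, 0 <= K z <= 1).
Variables (t1 t2 : penalty).

(** The Gibbs plan attached to a pair of potentials. *)
Definition plan_density (phi : X -> R) (psi : Y -> R) (z : Z) : R :=
  expR ((phi (pi1 z) + psi (pi2 z)) / eps) * K z.

(** The dual functional for potentials lying below the weights: the minimum
    of the potential and the weight is then the potential. *)
Definition dual_real (phi : X -> R) (psi : Y -> R) : R :=
  - (eps * \int[rho]_z ((expR ((phi (pi1 z) + psi (pi2 z)) / eps) - 1) * K z))
  + \int[dx]_x (phi x * f x) + \int[dy]_y (psi y * g y).

Lemma bm_exponent phi psi : bm phi -> bm psi ->
  bm (fun z => (phi (pi1 z) + psi (pi2 z)) / eps).
Proof.
move=> bphi bpsi; apply: (bmM (g := fun=> eps^-1)); last exact: bm_cst.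
by apply: bmD; [exact: (bm_comp mpi1)|exact: (bm_comp mpi2)].
Qed.

Lemma bm_plan_density phi psi : bm phi -> bm psi -> bm (plan_density phi psi).
Proof.
by move=> bphi bpsi; apply: bmM => //; apply: bm_exp; exact: bm_exponent.
Qed.

Lemma bm_dual_integrand phi psi : bm phi -> bm psi ->
  bm (fun z => (expR ((phi (pi1 z) + psi (pi2 z)) / eps) - 1) * K z).
Proof.
move=> bphi bpsi; apply: bmM => //; apply: bmB; last exact: bm_cst.
by apply: bm_exp; exact: bm_exponent.
Qed.

Let bmi (h : Z -> R) : bm h -> L1 rho h. Proof. exact: bm_L1_prob. Qed.

Local Notation box1 M := (in_box D1 l1 t1 M).
Local Notation box2 M := (in_box D2 l2 t2 M).

Lemma in_box_bound {d} {T : measurableType d} (D : set T) l t M (phi : T -> R) B :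
  (forall x, `|(l \_ D) x| <= B) -> 0 <= M -> in_box D l t M phi ->
  forall x, `|phi x| <= B + M.
Proof.
move=> lB M0 [_ box] x; have := box x; have := lB x.
rewrite !ler_norml => /andP[b1 b2] /andP[].
by case: t {box} => /= b3 b4; apply/andP; split; lra.
Qed.

Lemma in_box_convex {d} {T : measurableType d} (D : set T) l t M (phi phi' : T -> R) s :
  0 <= s <= 1 -> in_box D l t M phi -> in_box D l t M phi' ->
  in_box D l t M (fun x => phi x + s * (phi' x - phi x)).
Proof.
move=> /andP[s0 s1] [bphi box] [bphi' box']; split.
  apply: bmD => //; apply: (bmM (f := fun=> s)); first exact: bm_cst.
  exact: bmB.
move=> x; have /andP[b1 b2] := box x; have /andP[b3 b4] := box' x.
move: (box_floor _ _ _ _ _) ((l \_ D) x) b1 b2 b3 b4 => a b b1 b2 b3 b4.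
by apply/andP; split; nra.
Qed.

Lemma dual_near_max (M delta : R) : 0 <= M -> 0 < delta -> exists phi psi,
  [/\ box1 M phi, box2 M psi & forall phi' psi', box1 M phi' -> box2 M psi' ->
   dual_real phi' psi' <= dual_real phi psi + delta].
Proof.
move=> M0 de0.
pose E := [set dual_real phi psi | phi in box1 M & psi in box2 M].
have iK := bmi bK.
have supE : has_sup E.
  split.
    exists (dual_real lam1 lam2); exists lam1.
      by split => // x; rewrite lexx andbT box_floor_le.
    exists lam2 => //.
    by split => // x; rewrite lexx andbT box_floor_le.
  exists (eps * \int[rho]_z K z + \int[dx]_x (lam1 x * f x) + \int[dy]_y (lam2 y * g y)).
  move=> _ [phi [bphi phib]] [psi [bpsi psib]] <-.
  apply: lerD; last first.
    apply: Rint_le; [exact: L1M|exact: L1M|move=> y].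
    by rewrite ler_wpM2r//; have /andP[] := psib y.
  apply: lerD; last first.
    apply: Rint_le; [exact: L1M|exact: L1M|move=> y].
    by rewrite ler_wpM2r//; have /andP[] := phib y.
  rewrite -mulrN ler_pM2l// lerNl -[leLHS]mulN1r -(RintZ (-1) iK).
  apply: Rint_le; [exact: L1Z|exact/bmi/bm_dual_integrand|move=> z].
  rewrite ler_wpM2r//; first by have /andP[] := K01 z.
  by rewrite -subr_ge0 opprK subrK expR_ge0.
have [_ [phi bphi [psi bpsi <-]] near] := sup_adherent de0 supE.
exists phi, psi; split => // phi' psi' bphi' bpsi'.
rewrite -lerBlDr; apply: le_trans (ltW near); rewrite lerB// .
by apply: (sup_ubound supE.2); exists phi' => //; exists psi'.
Qed.

(** The left-hand side is the derivative of the dual at (phi, psi) in the direction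
    of (phi', psi').  A step of length s in that direction increases the dual by at
    least s times this derivative minus C s^2, and by at most the defect in
    maximality; with a defect of s eta / 2 and s C <= eta / 2 the bound follows. *)
Lemma dual_first_order (M eta : R) : 0 <= M -> 0 < eta -> exists phi psi,
  [/\ box1 M phi, box2 M psi & forall phi' psi', box1 M phi' -> box2 M psi' ->
   (\int[dx]_x ((phi' x - phi x) * f x)
    - \int[rho]_z ((phi' (pi1 z) - phi (pi1 z)) * plan_density phi psi z))
   + (\int[dy]_y ((psi' y - psi y) * g y)
    - \int[rho]_z ((psi' (pi2 z) - psi (pi2 z)) * plan_density phi psi z)) <= eta].
Proof.
move=> M0 eta0.
have [_ [B1 lB1]] := bl1; have [_ [B2 lB2]] := bl2.
pose B := `|B1| + `|B2| + M.
have B0 : 0 <= B by rewrite /B !addr_ge0.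
(* H bounds the directions h below, and P bounds the Gibbs plan. *)
pose H := 4 * B + 1.
pose P := expR (2 * B / eps).
pose C := 2 * H ^+ 2 / eps * P.
have H0 : 0 < H by rewrite /H; lra.
have C0 : 0 < C by rewrite /C !mulr_gt0 ?invr_gt0 ?exprn_gt0 ?expR_gt0.
have C20 : 0 < 2 * C by apply: mulr_gt0.
have H20 : 0 < 2 * H by apply: mulr_gt0.
pose s := Num.min 1 (Num.min (eps / (2 * H)) (eta / (2 * C))).
have s0 : 0 < s.
  by rewrite /s !lt_min ltr01/= !divr_gt0.
have s1 : s <= 1 by rewrite /s ge_min lexx.
have sH : s * H <= eps / 2.
  have : s <= eps / (2 * H) by rewrite /s !ge_min lexx orbT.
  by rewrite (ler_pdivlMr _ _ H20) => sH; rewrite ler_pdivlMr// mulrC mulrCA.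
have sC : s * C <= eta / 2.
  have : s <= eta / (2 * C) by rewrite /s !ge_min lexx !orbT.
  by rewrite (ler_pdivlMr _ _ C20) => sC; rewrite ler_pdivlMr// mulrC mulrCA.
have de0 : 0 < s * (eta / 2) by rewrite mulr_gt0// divr_gt0.
have [phi [psi [bphi bpsi near]]] := dual_near_max M0 de0.
exists phi, psi; split => // phi' psi' bphi' bpsi'.
have s01 : 0 <= s <= 1 by rewrite ltW.
have := near _ _ (in_box_convex s01 bphi bphi') (in_box_convex s01 bpsi bpsi').
have [cphi _] := bphi; have [cpsi _] := bpsi.
have [cphi' _] := bphi'; have [cpsi' _] := bpsi'.
pose p := plan_density phi psi.
have bp : bm p by exact: bm_plan_density.
have b1 := bmB cphi' cphi; have b2 := bmB cpsi' cpsi.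
have b1pi := bm_comp mpi1 b1; have b2pi := bm_comp mpi2 b2.
pose h z := phi' (pi1 z) - phi (pi1 z) + (psi' (pi2 z) - psi (pi2 z)).
have bh : bm h by exact: bmD.
have bound1 phi0 x : box1 M phi0 -> `|phi0 x| <= B.
  move=> bx; apply: le_trans (in_box_bound lB1 M0 bx x) _.
  by rewrite /B lerD2r (le_trans (ler_norm _))// lerDl.
have bound2 psi0 x : box2 M psi0 -> `|psi0 x| <= B.
  move=> bx; apply: le_trans (in_box_bound lB2 M0 bx x) _.
  by rewrite /B lerD2r (le_trans (ler_norm _))// lerDr.
have hH z : `|h z| <= H.
  have := bound1 _ (pi1 z) bphi; have := bound1 _ (pi1 z) bphi'.
  have := bound2 _ (pi2 z) bpsi; have := bound2 _ (pi2 z) bpsi'.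
  rewrite /h /H !ler_norml => /andP[? ?] /andP[? ?] /andP[? ?] /andP[? ?].
  by apply/andP; split; lra.
have p0 z : 0 <= p z.
  by rewrite /p /plan_density mulr_ge0 ?expR_ge0//; have /andP[] := K01 z.
have pP z : p z <= P.
  have /andP[k0 k1] := K01 z.
  rewrite /p /plan_density -[P]mulr1 ler_pM ?expR_ge0// ler_expR ler_pM2r ?invr_gt0//.
  have := bound1 _ (pi1 z) bphi; have := bound2 _ (pi2 z) bpsi.
  by rewrite !ler_norml => /andP[? ?] /andP[? ?]; lra.
pose phis x := phi x + s * (phi' x - phi x).
pose psis y := psi y + s * (psi' y - psi y).
rewrite -/phis -/psis.
have [cphis _] := in_box_convex s01 bphi bphi'.
have [cpsis _] := in_box_convex s01 bpsi bpsi'.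
have key : eps * \int[rho]_z ((expR ((phis (pi1 z) + psis (pi2 z)) / eps) - 1) * K z)
    <= eps * \int[rho]_z ((expR ((phi (pi1 z) + psi (pi2 z)) / eps) - 1) * K z)
       + s * \int[rho]_z (h z * p z) + s ^+ 2 * C.
  have hpi : L1 rho (fun z => h z * p z) by apply: bmi; exact: bmM.
  have ii := bmi (bm_dual_integrand cphi cpsi).
  have iis := bmi (bm_dual_integrand cphis cpsis).
  have -> : s ^+ 2 * C = \int[rho]_z (s ^+ 2 * C) :> R.
    by rewrite Rint_cst.
  have ci : L1 rho (fun=> s ^+ 2 * C) by apply/bmi/bm_cst.
  rewrite -!RintZ// -RintD; [|exact: L1Z|exact: L1Z].
  rewrite -RintD//; last by apply: L1D; exact: L1Z.
  apply: Rint_le; [exact: L1Z|by apply: L1D => //; apply: L1D; exact: L1Z|move=> z].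
  have -> : (phis (pi1 z) + psis (pi2 z)) / eps =
      (phi (pi1 z) + psi (pi2 z)) / eps + s * h z / eps.
    by rewrite /phis /psis /h; field; rewrite gt_eqF.
  rewrite expRD.
  set E := expR ((phi (pi1 z) + psi (pi2 z)) / eps).
  have shb : `|s * h z / eps| <= 1 / 2.
    rewrite !normrM (gtr0_norm s0) normfV (gtr0_norm eps0) ler_pdivrMr//.
    have : s * `|h z| <= s * H by rewrite ler_pM2l.
    lra.
  have q := expR_le_quadratic shb.
  have pE : p z = E * K z by [].
  have {q} : eps * (p z * (expR (s * h z / eps) - 1)) <= eps * (p z * (s * h z / eps + 2 * (s * h z / eps) ^+ 2)).
    by rewrite ler_pM2l// ler_wpM2l//; lra.
  have : eps * (p z * (2 * (s * h z / eps) ^+ 2)) <= s ^+ 2 * C.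
    rewrite (_ : eps * _ = s ^+ 2 * (2 * (h z ^+ 2) / eps * p z)); last by field; rewrite gt_eqF.
    rewrite ler_pM2l ?exprn_gt0// /C ler_pM//.
      by apply: divr_ge0 (ltW eps0); rewrite mulr_ge0// sqr_ge0.
    rewrite ler_pM2r ?invr_gt0// ler_pM2l//.
    by rewrite -real_normK ?num_real// ler_pXn2r ?nnegrE// ltW.
  have -> : eps * (p z * (s * h z / eps + 2 * (s * h z / eps) ^+ 2)) =
     s * (h z * p z) + eps * (p z * (2 * (s * h z / eps) ^+ 2)).
    by field; rewrite gt_eqF.
  rewrite pE; move: (expR (s * _ / _)) => e'; lra.
rewrite /dual_real.
have -> : \int[dx]_x (phis x * f x) =
    \int[dx]_x (phi x * f x) + s * \int[dx]_x ((phi' x - phi x) * f x).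
  rewrite -RintZ; last exact: L1M.
  rewrite -RintD; [|exact: L1M|apply: L1Z; exact: L1M].
  by apply: Rint_eq => x; rewrite /phis; ring.
have -> : \int[dy]_y (psis y * g y) =
    \int[dy]_y (psi y * g y) + s * \int[dy]_y ((psi' y - psi y) * g y).
  rewrite -RintZ; last exact: L1M.
  rewrite -RintD; [|exact: L1M|apply: L1Z; exact: L1M].
  by apply: Rint_eq => x; rewrite /psis; ring.
have hE : \int[rho]_z (h z * p z) = \int[rho]_z ((phi' (pi1 z) - phi (pi1 z)) * p z)
    + \int[rho]_z ((psi' (pi2 z) - psi (pi2 z)) * p z).
  rewrite -RintD; [|apply: bmi; exact: bmM..].
  by apply: Rint_eq => z; rewrite mulrDl.
move: key; rewrite hE.
rewrite -/p => key H'.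
rewrite -(ler_pM2l s0).
have : s * (s * C) <= s * (eta / 2) by rewrite ler_pM2l.
lra.
Qed.

End first_order.

(** * Closing the duality gap *)

(** This and the next lemma make the entropy and the cost of a plan dominated by
    a multiple of K integrable, although c may be unbounded. *)
Lemma entropy_bounds (R : realType) (t C : R) : 0 <= t -> t <= C ->
  `|(ln t - 1) * t| <= 1 + C ^+ 2.
Proof.
move=> t0 tC; have C0 := le_trans t0 tC.
have C20 : 0 <= C ^+ 2 by exact: sqr_ge0.
have [->|tn0] := eqVneq t 0; first by rewrite mulr0 normr0 addr_ge0.
have tp : 0 < t by rewrite lt_def tn0.
have h1 := expR_ge1Dx (ln t); rewrite lnK ?posrE// in h1.
have h2 := expR_ge1Dx (- ln t); rewrite expRN lnK ?posrE// in h2.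
have tC2 : t * t <= C ^+ 2 by rewrite expr2 ler_pM.
have : t * (1 - ln t) <= 1 by rewrite -[leRHS](mulfV tn0) ler_pM2l.
have : t * (1 + ln t) <= t * t by rewrite ler_pM2l.
move=> u1 u2; rewrite ler_norml; apply/andP; split.
  lra.
lra.
Qed.

Lemma cost_gibbs_le (R : realType) (c eps : R) : 0 < eps -> 0 <= c ->
  c * expR (- c / eps) <= eps.
Proof.
move=> e0; rewrite le_eqVlt => /predU1P[<-|c0]; first by rewrite mul0r ltW.
rewrite mulNr; have := expRN_le_inv (divr_gt0 c0 e0); rewrite invf_div.
by rewrite ler_pdivlMr// => ce; rewrite mulrC.
Qed.

Section strong_duality_real.
Context {d1 d2 d3 : measure_display} {X : measurableType d1} {Y : measurableType d2}.
Context {Z : measurableType d3} {R : realType}.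
Variables (dx : probability X R) (dy : probability Y R) (rho : probability Z R).
Variables (pi1 : Z -> X) (pi2 : Z -> Y).
Hypotheses (mpi1 : measurable_fun [set: Z] pi1)
  (rho_pi1 : forall A, measurable A -> rho (pi1 @^-1` A) = dx A).
Hypotheses (mpi2 : measurable_fun [set: Z] pi2)
  (rho_pi2 : forall A, measurable A -> rho (pi2 @^-1` A) = dy A).
Variables (D1 : set X) (l1 : X -> R) (D2 : set Y) (l2 : Y -> R).
Hypotheses (bl1 : bm (l1 \_ D1)) (l10 : forall x, 0 <= (l1 \_ D1) x).
Hypotheses (bl2 : bm (l2 \_ D2)) (l20 : forall x, 0 <= (l2 \_ D2) x).
Local Notation lam1 := (l1 \_ D1).
Local Notation lam2 := (l2 \_ D2).
Variables (mu : {measure set X -> \bar R}) (nu : {measure set Y -> \bar R}).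
Variables (f : X -> R) (g : Y -> R).
Hypotheses (muoo : (mu [set: X] < +oo)%E) (nuoo : (nu [set: Y] < +oo)%E).
Hypotheses (df : is_density mu dx f) (dg : is_density nu dy g).
Variables (eps : R) (eps0 : 0 < eps) (c : Z -> R).
Hypotheses (mc : measurable_fun [set: Z] c) (c0 : forall z, 0 <= c z).
Variables (t1 t2 : penalty).

Local Notation box1 M := (in_box D1 l1 t1 M).
Local Notation box2 M := (in_box D2 l2 t2 M).
Local Notation K := (fun z => expR (- c z / eps)).

Lemma gibbs_bm : bm K.
Proof.
split.
  apply: measurableT_comp => //; apply: measurable_funM => //.
  exact: measurableT_comp.
exists 1 => z; rewrite ger0_norm ?expR_ge0// expR_le1 mulNr oppr_le0.
by rewrite divr_ge0// ltW.
Qed.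

Lemma gibbs01 z : 0 <= K z <= 1.
Proof.
by rewrite expR_ge0 expR_le1 mulNr oppr_le0 divr_ge0// ltW.
Qed.

(** Where s <= W the left-hand side is at most W q.  Elsewhere the decay of p
    in s compensates the factor s. *)
Lemma repair_excess (s p q W E0 : R) : 0 <= q -> q <= p -> 0 < W -> 0 <= E0 ->
  0 <= s -> p <= E0 * expR (- (s / eps)) -> s * q <= W * q + 4 * eps ^+ 2 * E0 / W.
Proof.
move=> q0 qp W0 E00 s0 pE.
have e40 : 0 <= 4 * eps ^+ 2 by rewrite mulr_ge0 ?sqr_ge0.
have r0 : 0 <= 4 * eps ^+ 2 * E0 / W by rewrite divr_ge0 ?(ltW W0)// mulr_ge0.
have [sW|Ws] := leP s W.
  by have : s * q <= W * q by [rewrite ler_wpM2r]; lra.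
have s_gt0 := lt_trans W0 Ws.
have h := mulr_expRN_le eps0 s_gt0.
have sq : s * q <= s * p by rewrite ler_pM2l.
have sp : s * p <= E0 * (s * expR (- (s / eps))) by rewrite mulrCA ler_pM2l.
have Eh : E0 * (s * expR (- (s / eps))) <= E0 * (4 * eps ^+ 2 / s) by rewrite ler_wpM2l.
have : E0 * (4 * eps ^+ 2 / s) <= 4 * eps ^+ 2 * E0 / W.
  rewrite mulrA (mulrC E0); apply: ler_wpM2l; first exact: mulr_ge0.
  by rewrite lef_pV2 ?posrE// ltW.
have : 0 <= W * q by rewrite mulr_ge0// ltW.
lra.
Qed.

(** The factors ta and tb repair the two marginals, and s is the slack between the
    weight and the potential for the first one.  Repairing the second marginal
    removes the mass of (1 - tb) p, at a cost of s per unit. *)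
Lemma cross_excess (p s ta tb : Z -> R) (W E0 : R) :
  bm p -> bm s -> bm ta -> bm tb -> (forall z, 0 <= p z) -> (forall z, 0 <= s z) ->
  (forall z, 0 <= ta z <= 1) -> (forall z, 0 <= tb z <= 1) -> 0 < W -> 0 <= E0 ->
  (forall z, p z <= E0 * expR (- (s z / eps))) ->
  \int[rho]_z (s z * (ta z * p z - ta z * tb z * p z))
  <= W * \int[rho]_z ((1 - tb z) * p z) + 4 * eps ^+ 2 * E0 / W.
Proof.
move=> bp bs bta btb p0 s0 ta01 tb01 W0 E00 pE.
have b1tb : bm (fun z => (1 - tb z) * p z).
  by apply: bmM => //; apply: bmB => //; exact: bm_cst.
have i1tb := bm_L1_prob rho b1tb.
rewrite -[X in _ <= _ + X](Rint_cst rho) -(RintZ W i1tb) -RintD; [|exact: L1Z|].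
- apply: Rint_le.
  + apply: bm_L1_prob; apply: bmM => //.
    by apply: bmB; apply: bmM => //; exact: bmM.
  + by apply: L1D; [exact: L1Z|apply: bm_L1_prob; exact: bm_cst].
  move=> z; have /andP[ta0 ta1] := ta01 z; have /andP[tb0 tb1] := tb01 z.
  have q0 : 0 <= (1 - tb z) * p z by rewrite mulr_ge0// subr_ge0.
  apply: (@le_trans _ _ (s z * ((1 - tb z) * p z))).
    rewrite ler_wpM2l// (_ : _ - _ = ta z * ((1 - tb z) * p z)); last by ring.
    by rewrite ler_piMl.
  by apply: (repair_excess (p := p z)) => //; rewrite ler_piMl// gerBl.
- by apply: bm_L1_prob; exact: bm_cst.
Qed.

(** The parameters are chosen in the order W, M, eta.  The final error is at most
    eta + (W + eps) (m1 + m2) + 2 C0 / W, where m1 and m2 are the masses removed by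
    the two repairs: eta <= e / 4 and the last term is e / 4 by the choice of W,
    while m1 + m2 <= C1 / M makes the middle term at most e / 4. *)
Lemma no_duality_gap (e : R) : 0 < e ->
  exists M phi psi (gamma : {measure set Z -> \bar R}) (p' : Z -> R),
  [/\ 0 < M, box1 M phi, box2 M psi,
    [/\ (gamma [set: Z] < +oo)%E, is_density gamma rho p',
      bm (fun z => c z * p' z) & bm (fun z => (ln (p' z) - 1) * p' z)] &
    ((\int[rho]_z (c z * p' z) + eps * \int[rho]_z ((ln (p' z) - 1) * p' z)
      + eps * \int[rho]_z K z)%:E
     + primal_penalty t1 D1 l1 (pushforward gamma pi1) mu
     + primal_penalty t2 D2 l2 (pushforward gamma pi2) nu
     <= (dual_real dx dy rho pi1 pi2 f g eps K phi psi + e)%:E)%E].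
Proof.
move=> e0.
have fi := is_density_L1 df muoo; have gi := is_density_L1 dg nuoo.
have [mf f0 _] := df; have [mg g0 _] := dg.
have bK := gibbs_bm; have K01 := gibbs01.
have bmi (h : Z -> R) : bm h -> L1 rho h by exact: bm_L1_prob.
have [_ [B1 lB1]] := bl1; have [_ [B2 lB2]] := bl2.
pose B := `|B1| + `|B2|.
have B0 : 0 <= B by rewrite addr_ge0.
have l1B x : lam1 x <= B.
  by rewrite (le_trans (ler_norm _))// (le_trans (lB1 x))// (le_trans (ler_norm _))// lerDl.
have l2B x : lam2 x <= B.
  by rewrite (le_trans (ler_norm _))// (le_trans (lB2 x))// (le_trans (ler_norm _))// lerDr.
(* E0 K bounds the Gibbs plan, and C0 is the constant of the excess estimate. *)
pose E0 := expR (2 * B / eps).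
have E00 : 0 < E0 by exact: expR_gt0.
pose C0 := 4 * eps ^+ 2 * E0.
have C00 : 0 < C0 by rewrite /C0 !mulr_gt0// exprn_gt0.
pose W := 8 * C0 / e.
have W0 : 0 < W by rewrite /W !divr_gt0// mulr_gt0.
have CW : 2 * (C0 / W) = e / 4.
  by rewrite /W; field; rewrite !gt_eqF.
pose Q := expR (B / eps).
have Q0 : 0 < Q by exact: expR_gt0.
pose C1 := 2 + 4 * eps * Q.
have C10 : 0 < C1 by rewrite addr_gt0// !mulr_gt0.
pose M := (W + eps) * C1 * 4 / e.
have M0 : 0 < M by rewrite /M divr_gt0// !mulr_gt0// addr_gt0.
have CM : (W + eps) * (C1 / M) = e / 4.
  by rewrite /M; field; rewrite !gt_eqF// addr_gt0.
pose eta := Num.min 1 (e / 4).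
have eta0 : 0 < eta by rewrite lt_min ltr01 divr_gt0.
have eta1 : eta <= 1 by rewrite ge_min lexx.
have etae : eta <= e / 4 by rewrite ge_min lexx orbT.
have [phi [psi [bphi bpsi first_order]]] := dual_first_order rho mpi1 mpi2 bl1 l10
  bl2 l20 fi gi f0 g0 eps0 bK K01 t1 t2 (ltW M0) eta0.
have [cphi phib] := bphi; have [cpsi psib] := bpsi.
pose p := plan_density pi1 pi2 eps K phi psi.
have bp : bm p by exact: bm_plan_density.
have ip : L1 rho p := bmi _ bp.
have p_gt0 z : 0 < p z by rewrite mulr_gt0 ?expR_gt0.
have p0 z : 0 <= p z := ltW (p_gt0 z).
have [th1 [chi1 [bth1 th1b bchi1 [m1E pen1]]]] :=
  one_sided_repair mpi1 rho_pi1 bl1 l10 muoo df M0 ip p0 bphi.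
have [th2 [chi2 [bth2 th2b bchi2 [m2E pen2]]]] :=
  one_sided_repair mpi2 rho_pi2 bl2 l20 nuoo dg M0 ip p0 bpsi.
have {first_order} := first_order _ _ bchi1 bchi2; rewrite -/p.
move: m1E pen1 m2E pen2.
set G1 := _ - \int[rho]_z ((chi1 _ - _) * _).
set G2 := _ - \int[rho]_z ((chi2 _ - _) * _).
move=> m1E pen1 m2E pen2 G12.
pose p' z := th1 (pi1 z) * th2 (pi2 z) * p z.
have bth1' := bm_comp mpi1 bth1; have bth2' := bm_comp mpi2 bth2.
have bphi' := bm_comp mpi1 cphi; have bpsi' := bm_comp mpi2 cpsi.
have bl1' := bm_comp mpi1 bl1; have bl2' := bm_comp mpi2 bl2.
have bp' : bm p' by apply: bmM => //; exact: bmM.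
have p'0 z : 0 <= p' z.
  have /andP[? _] := th1b (pi1 z); have /andP[? _] := th2b (pi2 z).
  by rewrite !mulr_ge0.
have [mp' _] := bp'.
pose gamma : {measure set Z -> \bar R} := density_measure rho mp' p'0.
have goo : (gamma [set: Z] < +oo)%E.
  by rewrite /gamma/= /density_measure (Rint_EFin (bmi _ bp')) ltry.
have dp' : is_density gamma rho p' by exact: density_measureP.
have p'1 z : p' z <= th1 (pi1 z) * p z.
  have /andP[? ?] := th1b (pi1 z); have /andP[? ?] := th2b (pi2 z).
  by rewrite /p' mulrAC ler_piMr// mulr_ge0.
have p'2 z : p' z <= th2 (pi2 z) * p z.
  have /andP[? ?] := th1b (pi1 z); have /andP[? ?] := th2b (pi2 z).
  by rewrite /p' -mulrA ler_piMl// mulr_ge0.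
have p'p z : p' z <= p z.
  apply: le_trans (p'1 z) _; have /andP[? ?] := th1b (pi1 z); exact: ler_piMl.
have phiB x : phi x <= B by have /andP[_ /le_trans] := phib x; apply.
have psiB x : psi x <= B by have /andP[_ /le_trans] := psib x; apply.
(* mass removed *)
(* Where a potential is below - M / 2 the Gibbs plan is of order exp (- M / (2 eps)). *)
have small (h : Z -> R) : measurable_fun [set: Z] h ->
    (forall z, h z < - M / 2 -> p z <= expR ((B - M / 2) / eps)) ->
    \int[rho]_z (\1_[set z | h z < - M / 2] z * p z) <= Q * (2 * eps / M).
  move=> mh hp.
  have bA : bm (\1_[set z | h z < - M / 2] : Z -> R).
    by apply: bm_indic; exact: measurable_lt_set.
  apply: (@le_trans _ _ (\int[rho]_z (Q * (2 * eps / M)))); last first.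
    by rewrite Rint_cst.
  apply: Rint_le; [exact: L1M|exact/bmi/bm_cst|move=> z].
  have Qp : 0 <= Q * (2 * eps / M) by apply/ltW/mulr_gt0 => //; apply: divr_gt0 => //; exact: mulr_gt0.
  rewrite indicE; case: (boolP (_ \in _)); rewrite ?mul0r// inE/= mul1r => hz.
  apply: le_trans (hp _ hz) _; rewrite mulrBl expRD ler_pM2l//.
  rewrite (_ : - _ = - (M / (2 * eps))); last by field; rewrite gt_eqF.
  by rewrite -(invf_div M (2 * eps)); apply: expRN_le_inv; rewrite divr_gt0// mulr_gt0.
have pK z : p z <= expR ((phi (pi1 z) + psi (pi2 z)) / eps).
  by rewrite /p /plan_density ler_piMr ?expR_ge0//; have /andP[] := K01 z.
have sm1 : \int[rho]_z (\1_[set x | phi x < - M / 2] (pi1 z) * p z) <= Q * (2 * eps / M).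
  apply: (small (fun z => phi (pi1 z))); first by case: bphi'.
  move=> z hz; apply: le_trans (pK z) _; rewrite ler_expR ler_pM2r ?invr_gt0//.
  by have := psiB (pi2 z); lra.
have sm2 : \int[rho]_z (\1_[set x | psi x < - M / 2] (pi2 z) * p z) <= Q * (2 * eps / M).
  apply: (small (fun z => psi (pi2 z))); first by case: bpsi'.
  move=> z hz; apply: le_trans (pK z) _; rewrite ler_expR ler_pM2r ?invr_gt0//.
  by have := phiB (pi1 z); lra.
pose m1 := \int[rho]_z ((1 - th1 (pi1 z)) * p z).
pose m2 := \int[rho]_z ((1 - th2 (pi2 z)) * p z).
have m12 : m1 + m2 <= C1 / M.
  have GM : 2 / M * (G1 + G2) <= 2 / M.
    have tM0 : 0 <= 2 / M by apply: divr_ge0 => //; exact: ltW.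
    exact: (ler_piMr tM0 (le_trans G12 eta1)).
  have -> : C1 / M = 2 / M + (Q * (2 * eps / M) + Q * (2 * eps / M)).
    by rewrite /C1; move: (M) (Q) (M0) => M' Q' M'0; field; rewrite gt_eqF.
  move: m1E m2E; rewrite -/m1 -/m2 => m1E m2E; lra.
have L01 z : 0 <= lam1 (pi1 z) - phi (pi1 z).
  by rewrite subr_ge0; have /andP[] := phib (pi1 z).
have L02 z : 0 <= lam2 (pi2 z) - psi (pi2 z).
  by rewrite subr_ge0; have /andP[] := psib (pi2 z).
have X1 : \int[rho]_z ((lam1 (pi1 z) - phi (pi1 z)) * (th1 (pi1 z) * p z - p' z))
    <= W * m2 + C0 / W.
  apply: (cross_excess bp (bmB bl1' bphi') bth1' bth2' p0) => // [|z]; first exact: ltW.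
  apply: le_trans (pK z) _; rewrite /E0 -expRD ler_expR -mulrBl ler_pM2r ?invr_gt0//.
  by have := psiB (pi2 z); have := l1B (pi1 z); lra.
have X2 : \int[rho]_z ((lam2 (pi2 z) - psi (pi2 z)) * (th2 (pi2 z) * p z - p' z))
    <= W * m1 + C0 / W.
  under Rint_eq do rewrite /p' (mulrC (th1 _)).
  apply: (cross_excess bp (bmB bl2' bpsi') bth2' bth1' p0) => // [|z]; first exact: ltW.
  apply: le_trans (pK z) _; rewrite /E0 -expRD ler_expR -mulrBl ler_pM2r ?invr_gt0//.
  by have := phiB (pi1 z); have := l2B (pi2 z); lra.
have p'P z : p' z <= E0 * K z.
  apply: le_trans (p'p z) _; rewrite /p /plan_density ler_wpM2r ?expR_ge0//.
  rewrite ler_expR ler_pM2r ?invr_gt0//.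
  by have := phiB (pi1 z); have := psiB (pi2 z); lra.
have bcp' : bm (fun z => c z * p' z).
  split; first exact: measurable_funM.
  exists (E0 * eps) => z; rewrite (ger0_norm (mulr_ge0 (c0 z) (p'0 z))).
  apply: (@le_trans _ _ (c z * (E0 * K z))); first by rewrite ler_wpM2l.
  by rewrite mulrCA ler_pM2l//; exact: cost_gibbs_le.
have bent : bm (fun z => (ln (p' z) - 1) * p' z).
  have mlnp : measurable_fun [set: Z] (fun z => ln (p' z)).
    exact: (measurableT_comp (@measurable_ln R) mp').
  split; first by apply: measurable_funM => //; exact: measurable_funB.
  exists (1 + E0 ^+ 2) => z; apply: (entropy_bounds (p'0 z)).
  apply: le_trans (p'P z) _; rewrite ler_piMr ?(ltW E00)//.
  by have /andP[] := K01 z.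
exists M, phi, psi, gamma, p'; split => //.
have {}pen1 := pen1 _ _ goo dp' p'1; have {}pen2 := pen2 _ _ goo dp' p'2.
have bphip' : bm (fun z => phi (pi1 z) * p' z) by exact: bmM.
have bpsip' : bm (fun z => psi (pi2 z) * p' z) by exact: bmM.
(* Where p' > 0 one has eps ln p' <= eps ln p = phi + psi - c. *)
have cost : \int[rho]_z (c z * p' z) + eps * \int[rho]_z ((ln (p' z) - 1) * p' z)
   <= \int[rho]_z (phi (pi1 z) * p' z) + \int[rho]_z (psi (pi2 z) * p' z)
      - eps * \int[rho]_z p' z.
  rewrite -(RintZ eps (bmi _ bent)) -(RintZ eps (bmi _ bp')).
  rewrite -RintD; [|exact/bmi|exact/L1Z/bmi].
  rewrite -(RintD (bmi _ bphip') (bmi _ bpsip')) -RintB; [|by apply: L1D; exact: bmi|exact/L1Z/bmi].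
  apply: Rint_le; [by apply: L1D; [exact/bmi|exact/L1Z/bmi]| |move=> z].
    by apply: (L1B (f := fun z => _ + _)); [by apply: L1D; exact: bmi|exact/L1Z/bmi].
  have [->|pn0] := eqVneq (p' z) 0; first by rewrite !mulr0; lra.
  have p'_gt0 : 0 < p' z by rewrite lt_def pn0 p'0.
  have lnp : eps * ln (p' z) <= phi (pi1 z) + psi (pi2 z) - c z.
    have : ln (p' z) <= ln (p z) by rewrite ler_ln ?posrE.
    rewrite /p /plan_density -expRD expRK -mulrDl ler_pdivlMr// mulrC; exact.
  have : p' z * (eps * ln (p' z)) <= p' z * (phi (pi1 z) + psi (pi2 z) - c z).
    by rewrite ler_pM2l.
  lra.
have b1th1 : bm (fun z => (1 - th1 (pi1 z)) * p z).
  by apply: bmM => //; apply: bmB => //; exact: bm_cst.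
have b1th2 : bm (fun z => (1 - th2 (pi2 z)) * p z).
  by apply: bmM => //; apply: bmB => //; exact: bm_cst.
have mass : \int[rho]_z p z - \int[rho]_z p' z <= m1 + m2.
  rewrite -RintB; [|exact: ip|exact: bmi].
  rewrite -RintD; [|exact: bmi..].
  apply: Rint_le; [by apply: L1B => //; exact: bmi|by apply: L1D; exact: bmi|move=> z].
  have /andP[t10 t11] := th1b (pi1 z); have /andP[t20 t21] := th2b (pi2 z).
  have : 0 <= (1 - th1 (pi1 z)) * (1 - th2 (pi2 z)) * p z.
    by rewrite !mulr_ge0// subr_ge0.
  rewrite /p'; lra.
have dualE : dual_real dx dy rho pi1 pi2 f g eps K phi psi =
   - (eps * (\int[rho]_z p z - \int[rho]_z K z))
   + \int[dx]_x (phi x * f x) + \int[dy]_y (psi y * g y).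
  rewrite /dual_real -RintB; [|exact: ip|exact: bmi].
  by congr (- (_ * _) + _ + _); apply: Rint_eq => z; rewrite /p /plan_density; ring.
apply: le_trans (leeD (leeD (lexx _) pen1) pen2) _.
rewrite -!EFinD lee_fin dualE.
have We : (W + eps) * (m1 + m2) <= e / 4.
  by rewrite -CM ler_pM2l// addr_gt0.
have em : eps * (\int[rho]_z p z - \int[rho]_z p' z) <= eps * (m1 + m2).
  by rewrite ler_pM2l.
lra.
Qed.

End strong_duality_real.

(** * Weak duality *)

(** The Fenchel-Young inequality: t |-> (ln t - 1) t is the conjugate of the
    exponential. *)
Lemma entropy_young (R : realType) (t w : R) : 0 <= t ->
  t * w <= (ln t - 1) * t + expR w.
Proof.
move=> t0; have [->|tn0] := eqVneq t 0; first by rewrite mul0r mulr0 add0r expR_ge0.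
have tp : 0 < t by rewrite lt_def tn0.
have := expR_ge1Dx (w - ln t); rewrite expRD expRN lnK ?posrE// ler_pdivlMr//.
lra.
Qed.

Lemma penalty_ge0 disp (T : measurableType disp) (R : realType) t (D : set T)
    (l : T -> R) alpha beta : (0 <= primal_penalty t D l alpha beta)%E.
Proof.
case: t => /=; first exact: TV_ge0.
rewrite /PTVbar /PTV /iota_ind adde_ge0//; last by case: asboolP => _; rewrite ?lexx ?le0y.
by case: ifP => _; rewrite ?TV_ge0 ?le0y.
Qed.

Section weak_duality.
Context {d1 d2 d3 : measure_display} {X : measurableType d1} {Y : measurableType d2}.
Context {Z : measurableType d3} {R : realType}.
Variables (dx : probability X R) (dy : probability Y R) (rho : probability Z R).
Variables (pi1 : Z -> X) (pi2 : Z -> Y).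
Hypotheses (mpi1 : measurable_fun [set: Z] pi1)
  (rho_pi1 : forall A, measurable A -> rho (pi1 @^-1` A) = dx A).
Hypotheses (mpi2 : measurable_fun [set: Z] pi2)
  (rho_pi2 : forall A, measurable A -> rho (pi2 @^-1` A) = dy A).
Variables (D1 : set X) (l1 : X -> R) (D2 : set Y) (l2 : Y -> R).
Hypotheses (mD1 : measurable D1) (mD2 : measurable D2).
Hypotheses (bl1 : bm (l1 \_ D1)) (l10 : forall x, 0 <= (l1 \_ D1) x).
Hypotheses (bl2 : bm (l2 \_ D2)) (l20 : forall x, 0 <= (l2 \_ D2) x).
Local Notation lam1 := (l1 \_ D1).
Local Notation lam2 := (l2 \_ D2).
Variables (mu : {measure set X -> \bar R}) (nu : {measure set Y -> \bar R}).
Variables (f : X -> R) (g : Y -> R).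
Hypotheses (muoo : (mu [set: X] < +oo)%E) (nuoo : (nu [set: Y] < +oo)%E).
Hypotheses (df : is_density mu dx f) (dg : is_density nu dy g).
Variables (eps : R) (eps0 : 0 < eps) (c : Z -> R).
Hypotheses (mc : measurable_fun [set: Z] c) (c0 : forall z, 0 <= c z).
Variables (t1 t2 : penalty).
Local Notation K := (fun z => expR (- c z / eps)).

(** The two correction integrals on the left replace phi f by min (phi, lam1) f and
    psi g by min (psi, lam2) g.  Infinite entropy or infinite cost is harmless, since
    the other terms on the right are bounded below.  Otherwise the Fenchel-Young
    inequality at w = 1 bounds p by its entropy, so that gamma is finite. *)
Lemma weak_duality (gamma : {measure set Z -> \bar R}) p phi psi :
  is_density gamma rho p -> bm phi -> bm psi ->
  (t1 = PenTV -> {ae dx, forall x, - lam1 x <= phi x}) ->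
  (t2 = PenTV -> {ae dy, forall y, - lam2 y <= psi y}) ->
  ((dual_real dx dy rho pi1 pi2 f g eps K phi psi
    + \int[dx]_x ((Num.min (phi x) (lam1 x) - phi x) * f x)
    + \int[dy]_y ((Num.min (psi y) (lam2 y) - psi y) * g y))%:E <=
   \int[gamma]_z (c z)%:E + eps%:E * \int[rho]_z ((ln (p z) - 1) * p z)%:E
   + primal_penalty t1 D1 l1 (pushforward gamma pi1) mu
   + primal_penalty t2 D2 l2 (pushforward gamma pi2) nu
   + (eps * \int[rho]_z K z)%:E)%E.
Proof.
move=> dp bphi bpsi phi_ge psi_ge.
have [mp p0 pE] := dp.
have bK : bm K := gibbs_bm eps0 mc c0.
have bmi (h : Z -> R) : bm h -> L1 rho h by exact: bm_L1_prob.
pose h z := (ln (p z) - 1) * p z.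
have mh : measurable_fun [set: Z] h.
  apply: measurable_funM => //; apply: measurable_funB => //.
  exact: (measurableT_comp (@measurable_ln R) mp).
(* The entropy density h is at least - 1, so only its positive part can have infinite integral. *)
pose hp z := Num.max (h z) 0; pose hn z := Num.max (- h z) 0.
have hn1 z : 0 <= hn z <= 1.
  rewrite /hn le_max lexx orbT ge_max ler01 andbT/=.
  by have := entropy_young 0 (p0 z); rewrite mulr0 expR0 -/(h z); lra.
have bhn : bm hn.
  split; last by exists 1 => z; have /andP[? ?] := hn1 z; rewrite ger0_norm.
  by apply: measurable_maxr => //; exact: measurableT_comp.
have mhp : measurable_fun [set: Z] hp by exact: measurable_maxr.
have hp0 z : 0 <= hp z by rewrite /hp le_max lexx orbT.
have hE : (\int[rho]_z (h z)%:E = \int[rho]_z (hp z)%:E - (\int[rho]_z hn z)%:E)%E.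
  rewrite integralE -(Rint_EFin (bmi _ bhn)); congr (_ - _)%E.
    by apply: eq_integral => z _; rewrite funeposE EFin_max.
  by apply: eq_integral => z _; rewrite funenegE EFin_max.
have pen1_0 := penalty_ge0 t1 D1 l1 (pushforward gamma pi1) mu.
have pen2_0 := penalty_ge0 t2 D2 l2 (pushforward gamma pi2) nu.
have cost0 : (0 <= \int[gamma]_z (c z)%:E)%E by apply: integral_ge0 => z _; rewrite lee_fin.
have ninf (x : \bar R) : (0 <= x)%E -> (x != -oo)%E by case: x.
have [hpy|hpoo] := eqVneq (\int[rho]_z (hp z)%:E)%E +oo%E.
  rewrite hE hpy addye// gt0_muley ?lte_fin// addey ?ninf// addye ?ninf//.
  by rewrite addye ?ninf// addye// leey.
have hpi : L1 rho hp by apply: ge0_L1 => //; rewrite ltey.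
have hi : L1 rho h.
  rewrite (_ : h = fun z => hp z - hn z); first exact: L1B (bmi _ bhn).
  apply/funext => z; rewrite /hp /hn.
  by case: (leP (h z) 0) => h0; case: (leP (- h z) 0) => h0'; lra.
have ip : L1 rho p.
  apply: (@L1_le _ _ _ _ _ (fun z => h z + expR 1)) => // [z|].
    by rewrite ger0_norm//; have := entropy_young 1 (p0 z); rewrite mulr1.
  by apply: L1D => //; exact/bmi/bm_cst.
have goo : (gamma [set: Z] < +oo)%E by rewrite pE// (Rint_EFin ip) ltry.
have cE : (\int[gamma]_z (c z)%:E = \int[rho]_z (c z * p z)%:E)%E.
  rewrite (is_density_integral_ge0 goo dp)//; exact/measurable_EFinP.
have [cy|coo] := eqVneq (\int[gamma]_z (c z)%:E)%E +oo%E.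
  rewrite cy (Rint_EFin hi) -EFinM addye// addye ?ninf//.
  by rewrite addye ?ninf// addye// leey.
have cpi : L1 rho (fun z => c z * p z).
  apply: ge0_L1; [exact: measurable_funM|by move=> z; rewrite mulr_ge0|].
  by rewrite -cE ltey.
have [u [du hu]] := marginal_density mpi1 rho_pi1 goo dp.
have [v [dv hv]] := marginal_density mpi2 rho_pi2 goo dp.
have pen1 := penalty_ge bl1 l10 (marginal_lty mpi1 goo) muoo du df bphi phi_ge.
have pen2 := penalty_ge bl2 l20 (marginal_lty mpi2 goo) nuoo dv dg bpsi psi_ge.
rewrite cE (Rint_EFin cpi) (Rint_EFin hi) -EFinM -EFinD.
apply: le_trans (leeD (leeD (leeD (lexx _) pen1) pen2) (lexx _)).
rewrite -!EFinD lee_fin -(hu _ bphi) -(hv _ bpsi).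
have fi := is_density_L1 df muoo; have gi := is_density_L1 dg nuoo.
have bmin1 := bm_min bphi bl1; have bmin2 := bm_min bpsi bl2.
have bphi' := bm_comp mpi1 bphi; have bpsi' := bm_comp mpi2 bpsi.
have -> : \int[dx]_x ((Num.min (phi x) (lam1 x) - phi x) * f x) =
    \int[dx]_x (Num.min (phi x) (lam1 x) * f x) - \int[dx]_x (phi x * f x).
  by rewrite -RintB; [apply: Rint_eq => x; rewrite mulrBl|exact: L1M..].
have -> : \int[dy]_y ((Num.min (psi y) (lam2 y) - psi y) * g y) =
    \int[dy]_y (Num.min (psi y) (lam2 y) * g y) - \int[dy]_y (psi y * g y).
  by rewrite -RintB; [apply: Rint_eq => x; rewrite mulrBl|exact: L1M..].
have bE := bm_dual_integrand mpi1 mpi2 eps bK bphi bpsi.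
suff : \int[rho]_z (phi (pi1 z) * p z) + \int[rho]_z (psi (pi2 z) * p z) <=
    \int[rho]_z (c z * p z) + eps * \int[rho]_z h z
    + eps * \int[rho]_z ((expR ((phi (pi1 z) + psi (pi2 z)) / eps) - 1) * K z)
    + eps * \int[rho]_z K z.
  by rewrite /dual_real; lra.
have ei : L1 rho (fun z => eps * h z) by exact: L1Z.
have Ei : L1 rho (fun z => eps * ((expR ((phi (pi1 z) + psi (pi2 z)) / eps) - 1) * K z)).
  exact/L1Z/bmi.
have Ki : L1 rho (fun z => eps * K z) by exact/L1Z/bmi.
have s1i : L1 rho (fun z => c z * p z + eps * h z) by exact: L1D.
have s2i := L1D s1i Ei; have s3i := L1D s2i Ki.
rewrite -(RintZ eps hi) -(RintZ eps (bmi _ bE)) -(RintZ eps (bmi _ bK)).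
rewrite -(RintD cpi ei) -(RintD s1i Ei) -(RintD s2i Ki) -RintD; [|exact: L1M..].
apply: Rint_le => //; first by apply: L1D; exact: L1M.
move=> z.
pose w := (phi (pi1 z) + psi (pi2 z) - c z) / eps.
have wE : expR w = expR ((phi (pi1 z) + psi (pi2 z)) / eps) * K z.
  by rewrite /w mulrBl expRD mulNr.
have := entropy_young w (p0 z); rewrite -/(h z) -(ler_pM2l eps0) wE.
have -> : eps * (p z * w) = p z * (phi (pi1 z) + psi (pi2 z) - c z).
  by rewrite /w; field; rewrite gt_eqF.
move: (expR _) => E; move: (expR _) => E'; lra.
Qed.

End weak_duality.

(** * Essentially bounded potentials *)

Section essentially_bounded.
Context {disp : measure_display} {T : measurableType disp} {R : realType}.
Variable (m : probability T R).

Let m_gt0 : (0 < m [set: T])%E.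
Proof. by rewrite [X in (_ < X)%E](probability_setT m) lte01. Qed.

Lemma bm_Lfun_infty (f : T -> R) : bm f -> f \in Lfun m +oo%E.
Proof.
move=> [mf [M fM]]; rewrite inE; apply/andP; split; first by rewrite inE.
rewrite inE /= /finite_norm unlock /= m_gt0.
apply: (@le_lt_trans _ _ M%:E); last by rewrite ltry.
by apply/ess_supP/nearW => x /=; rewrite lee_fin.
Qed.

(** Truncation at an essential bound. *)
Lemma Lfun_infty_bm (f : T -> R) : f \in Lfun m +oo%E ->
  exists g, bm g /\ {ae m, forall x, f x = g x}.
Proof.
rewrite inE => /andP[]; rewrite !inE /= => mf.
rewrite /finite_norm unlock /= m_gt0 => foo.
have [M fM] : exists M, \forall x \ae m, (`|f x| <= M)%R.
  exact: ess_supr_bounded foo.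
exists (fun x => Num.max (- `|M|) (Num.min (f x) `|M|)); split.
  split; first by apply: measurable_maxr => //; exact: measurable_minr.
  exists `|M| => x; rewrite ler_norml le_max lexx /= ge_max ge_min lexx orbT andbT.
  by rewrite ge0_cp.
apply: filterS fM => x fM; have := le_trans fM (ler_norm M).
by rewrite ler_norml => /andP[? ?]; rewrite min_l// max_r.
Qed.

End essentially_bounded.

Lemma ae_marginal d1 d2 (Z : measurableType d1) (T : measurableType d2)
    (R : realType) (rho : probability Z R) (m : probability T R) (pi : Z -> T)
    (P : T -> Prop) : measurable_fun [set: Z] pi ->
  (forall A, measurable A -> rho (pi @^-1` A) = m A) ->
  {ae m, forall x, P x} -> {ae rho, forall z, P (pi z)}.
Proof.
move=> mpi rho_pi [N [mN N0 PN]]; exists (pi @^-1` N); split.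
- by rewrite -[X in measurable X]setTI; exact: mpi.
- by rewrite -N0; exact: rho_pi.
- by move=> z nP; apply: PN.
Qed.

Lemma integral_conull disp (T : measurableType disp) (R : realType)
    (m : {measure set T -> \bar R}) (D : set T) (f g : T -> \bar R) :
  measurable D -> m (~` D) = 0%E -> measurable_fun [set: T] g ->
  {ae m, forall x, D x -> f x = g x} -> measurable_fun D f ->
  (\int[m]_(x in D) f x = \int[m]_x g x)%E.
Proof.
move=> mD mD0 mg fg mf.
rewrite integral_mkcond; apply: ae_eq_integral => //.
  exact/(measurable_restrictT _ mD).
have Dae : {ae m, forall x, D x}.
  by exists (~` D); split => //; exact: measurableC.
apply: filterS2 Dae fg => x Dx fgx _.
by rewrite patchE mem_set// fgx.
Qed.

Lemma integral_conull_eq disp (T : measurableType disp) (R : realType)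
    (m : {measure set T -> \bar R}) (D : set T) (f g : T -> \bar R) :
  measurable D -> m (~` D) = 0%E -> measurable_fun [set: T] g ->
  (forall x, D x -> f x = g x) -> (\int[m]_(x in D) f x = \int[m]_x g x)%E.
Proof.
move=> mD mD0 mg fg; apply: integral_conull => //; first exact: aeW.
apply: (eq_measurable_fun g); last exact: measurable_funTS.
by move=> x /set_mem Dx; rewrite fg.
Qed.

Section dual_terms.
Context {disp : measure_display} {T : measurableType disp} {R : realType}.
Variables (D : set T) (l : T -> R) (m : probability T R).
Variables (beta : {measure set T -> \bar R}) (b : T -> R).
Hypotheses (mD : measurable D) (mD0 : m (~` D) = 0%E).
Hypotheses (ml : measurable_fun D l) (bl : bm (l \_ D)).
Hypotheses (boo : (beta [set: T] < +oo)%E) (db : is_density beta m b).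
Local Notation lam := (l \_ D).

Let betam : beta `<< m. Proof. exact: is_density_dominates db. Qed.

Let betaD0 : beta (~` D) = 0%E.
Proof.
by apply: ((null_content_dominatesP _ _).1 betam) => //; exact: measurableC.
Qed.

Let Dae : {ae m, forall x, D x}.
Proof. by exists (~` D); split => //; exact: measurableC. Qed.

(** Replacing phi by a bounded version phi' changes neither the integral, as
    beta is dominated by m, nor the constraint. *)
Lemma dual_termP t phi phi' : measurable_fun [set: T] phi -> bm phi' ->
  {ae m, forall x, phi x = phi' x} ->
  dual_term t D l m beta phi = -oo%E \/
  (dual_term t D l m beta phi =
     (\int[m]_x (Num.min (phi' x) (lam x) * b x))%:E /\
   (t = PenTV -> {ae m, forall x, - lam x <= phi' x})).
Proof.
move=> mphi bphi' phi_phi'.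
have intE : (\int[beta]_(x in D) (Num.min (phi x) (l x))%:E =
    (\int[m]_x (Num.min (phi' x) (lam x) * b x))%:E)%E.
  rewrite -(dual_integralE mD bl boo betaD0 db bphi').
  apply: ae_eq_integral => //.
  - by apply/measurable_EFinP; apply: measurable_minr => //; exact: measurable_funTS.
  - apply/measurable_EFinP; apply: measurable_minr => //.
    by apply: measurable_funTS; case: bphi'.
  - apply: (null_dominates_ae_eq mD betam).
    by apply: filterS phi_phi' => x -> _.
case: t => /=; last by right.
rewrite intE /iota_ind; case: asboolP => [[_ phi_ge _]|_]; last by left.
right; rewrite sube0; split => // _.
apply: filterS3 Dae phi_ge phi_phi' => x Dx /(_ Dx) lphi <-.
by rewrite patchE mem_set.
Qed.

(** The floor of the box for the TV penalty is - lam, so both dual constraints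
    hold; where l vanishes the box reduces to 0. *)
Lemma dual_term_box t M phi : (forall x, 0 <= lam x) -> in_box D l t M phi ->
  dual_term t D l m beta phi = (\int[m]_x (phi x * b x))%:E.
Proof.
move=> L0 [bphi box].
have intE : (\int[beta]_(x in D) (Num.min (phi x) (l x))%:E =
    (\int[m]_x (phi x * b x))%:E)%E.
  rewrite (dual_integralE mD bl boo betaD0 db bphi); congr EFin.
  by apply: Rint_eq => x; rewrite min_l//; have /andP[] := box x.
case: t box => /= box //; rewrite intE /iota_ind asboolT ?sube0//; split.
- exact: bm_Lfun_infty.
- apply: aeW => x Dx; have /andP[+ _] := box x.
  by rewrite /= patchE mem_set.
- apply: aeW => x Dx lx0; have /andP[] := box x.
  rewrite /= patchE mem_set// lx0 oppr0 => h1 h2.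
  by apply/eqP; rewrite eq_le h2.
Qed.

End dual_terms.

(** * Entropic optimal partial transport *)

Section product_probability.
Context {d1 d2 : measure_display} {X : measurableType d1} {Y : measurableType d2}.
Context {R : realType} (dx : probability X R) (dy : probability Y R).

Lemma product_fst A : measurable A -> (dx \x dy)%E (fst @^-1` A) = dx A.
Proof.
move=> mA; rewrite (_ : fst @^-1` A = A `*` [set: Y]).
  by rewrite product_measure1E//= [X in (_ * X)%E](probability_setT dy) mule1.
by apply/seteqP; split => -[x y] /= => [|[]].
Qed.

Lemma product_snd A : measurable A -> (dx \x dy)%E (snd @^-1` A) = dy A.
Proof.
move=> mA; rewrite (_ : snd @^-1` A = [set: X] `*` A).
  by rewrite product_measure1E//= [X in (X * _)%E](probability_setT dx) mul1e.
by apply/seteqP; split => -[x y] /= => [|[]].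
Qed.

Lemma product_conull A B : measurable A -> measurable B ->
  dx (~` A) = 0%E -> dy (~` B) = 0%E -> (dx \x dy)%E (~` (A `*` B)) = 0%E.
Proof.
move=> mA mB A0 B0; apply/eqP; rewrite eq_le measure_ge0 andbT.
have mA' := measurableC mA; have mB' := measurableC mB.
have mf : measurable (fst @^-1` (~` A) : set (X * Y)).
  by rewrite -[X in measurable X]setTI; exact: measurable_fst.
have ms : measurable (snd @^-1` (~` B) : set (X * Y)).
  by rewrite -[X in measurable X]setTI; exact: measurable_snd.
apply: (@le_trans _ _ ((dx \x dy)%E (fst @^-1` (~` A) `|` snd @^-1` (~` B)))).
  apply: le_measure; rewrite ?inE//.
  - by apply: measurableC; exact: measurableX.
  - exact: measurableU.
  - move=> [x y] /= nAB; have [Ax|nAx] := pselect (A x); last by left.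
    by right => By; apply: nAB.
apply: le_trans (measureU2 _ mf ms) _.
by rewrite [X in (X + _)%E](product_fst mA') [X in (_ + X)%E](product_snd mB') A0 B0 adde0.
Qed.

End product_probability.

Section duality.
Variables (R : realType) (d : nat) (Omega : set 'rV[R]_d).
Hypothesis (Omega_open : open Omega).
Variables (c : 'rV[R]_d * 'rV[R]_d -> R).
Hypotheses (c_ge0 : forall z, (Omega `*` Omega) z -> 0 <= c z)
  (c_lsc : lower_semicontinuous
     ((fun z => (c z)%:E) : subspace (Omega `*` Omega) -> \bar R)).
Variables (dx dy : probability 'rV[R]_d R).
Hypotheses (dx_Omega : dx (~` Omega) = 0%E) (dy_Omega : dy (~` Omega) = 0%E).
Variables (eps : R).
Hypothesis (eps0 : 0 < eps).
Local Notation E := 'rV[R]_d.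
Local Notation OO := (Omega `*` Omega).
Local Notation rho := (dx \x dy)%E.
Local Notation C := (c \_ OO).
Local Notation K := (fun z => expR (- C z / eps)).

Let mOmega : measurable Omega. Proof. exact: open_measurable_rV. Qed.
Let mOO : measurable OO. Proof. exact: measurableX. Qed.
Let rhoOO : rho (~` OO) = 0%E. Proof. exact: product_conull. Qed.

Let mcOO : measurable_fun OO c.
Proof.
by apply: lsc_measurable => //; exact: open_setX.
Qed.

Let mC : measurable_fun [set: E * E] C.
Proof. exact/(measurable_restrictT _ mOO). Qed.

Let C0 z : 0 <= C z.
Proof. by rewrite patchE; case: ifPn => // /set_mem; exact: c_ge0. Qed.

Lemma weight_restrict (l : E -> R) : measurable_fun Omega l ->
  (forall x, Omega x -> 0 <= l x) ->
  (exists M : R, forall x, Omega x -> l x <= M) ->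
  bm (l \_ Omega) /\ forall x, 0 <= (l \_ Omega) x.
Proof.
move=> ml l0 [M lM]; have lam0 x : 0 <= (l \_ Omega) x.
  by rewrite patchE; case: ifPn => // /set_mem; exact: l0.
split => //; split; first exact/(measurable_restrictT _ mOmega).
exists `|M| => x; rewrite ger0_norm// patchE; case: ifPn => [/set_mem Ox|_].
  exact: le_trans (lM _ Ox) (ler_norm _).
by rewrite normr_ge0.
Qed.

(** A Radon measure on an open set is sigma-finite, hence has a density, and
    integrability of the density makes it finite. *)
Lemma marginal_data (m : probability E R) (mu : {measure set E -> \bar R}) :
  radon_on Omega mu -> mu `<< m -> density mu m \in Lfun m 1%E ->
  is_density mu m (density mu m) /\ (mu [set: E] < +oo)%E.
Proof.
move=> [mu0 muC] mum mu1.
have [B [BP OB]] := compact_base_cover (@measurable0 _ _) (compact_base_rV R d) Omega_open.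
have dmu : is_density mu m (density mu m).
  apply: (@density_exists _ _ _ _ _ B) => //; last by rewrite -OB.
  by move=> k; have [mB cB BO] := BP k; split => //; exact: muC.
split => //; have [_ _ ->//] := dmu.
by rewrite (Rint_EFin ((Lfun1_integrable _ _).1 mu1)) ltry.
Qed.

Lemma plan_density_exists (gamma : {measure set (E * E) -> \bar R}) :
  radon_on OO gamma -> gamma `<< rho -> is_density gamma rho (density gamma rho).
Proof.
move=> [g0 gC] gr.
have oOO : open OO by exact: open_setX.
have [B [BP OB]] := compact_base_cover (@measurable0 _ _) (compact_base_rV2 R d) oOO.
apply: (@density_exists _ _ _ _ _ B) => //; last by rewrite -OB.
by move=> k; have [mB cB BO] := BP k; split => //; exact: gC.
Qed.


Let gibbs_integral :
  (\int[rho]_(z in OO) (gibbs c eps z)%:E = (\int[rho]_z K z)%:E)%E.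
Proof.
have bK : bm K := gibbs_bm eps0 mC C0.
rewrite (integral_conull_eq (g := fun z => (K z)%:E) mOO rhoOO).
- by rewrite Rint_EFin//; exact: bm_L1_prob.
- by apply/measurable_EFinP; case: bK.
- by move=> z OOz; rewrite /gibbs patchE mem_set.
Qed.

Variables (mu nu : {measure set E -> \bar R}).
Hypotheses (mu_radon : radon_on Omega mu) (nu_radon : radon_on Omega nu)
  (mu_dx : mu `<< dx) (nu_dy : nu `<< dy)
  (mu_L1 : density mu dx \in Lfun dx 1%E)
  (nu_L1 : density nu dy \in Lfun dy 1%E).
Variables (l1 l2 : E -> R).
Hypotheses (l1_meas : measurable_fun Omega l1) (l2_meas : measurable_fun Omega l2)
  (l1_ge0 : forall x, Omega x -> 0 <= l1 x)
  (l2_ge0 : forall x, Omega x -> 0 <= l2 x)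
  (l1_bounded : exists M : R, forall x, Omega x -> l1 x <= M)
  (l2_bounded : exists M : R, forall x, Omega x -> l2 x <= M).
Variables (t1 t2 : penalty).

Local Notation f := (density mu dx).
Local Notation g := (density nu dy).
Let df : is_density mu dx f. Proof. by have [] := marginal_data mu_radon mu_dx mu_L1. Qed.
Let muoo : (mu [set: E] < +oo)%E. Proof. by have [] := marginal_data mu_radon mu_dx mu_L1. Qed.
Let dg : is_density nu dy g. Proof. by have [] := marginal_data nu_radon nu_dy nu_L1. Qed.
Let nuoo : (nu [set: E] < +oo)%E. Proof. by have [] := marginal_data nu_radon nu_dy nu_L1. Qed.
Let bl1 : bm (l1 \_ Omega). Proof. by have [] := weight_restrict l1_meas l1_ge0 l1_bounded. Qed.
Let l10 x : 0 <= (l1 \_ Omega) x. Proof. by have [_] := weight_restrict l1_meas l1_ge0 l1_bounded. Qed.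
Let bl2 : bm (l2 \_ Omega). Proof. by have [] := weight_restrict l2_meas l2_ge0 l2_bounded. Qed.
Let l20 x : 0 <= (l2 \_ Omega) x. Proof. by have [_] := weight_restrict l2_meas l2_ge0 l2_bounded. Qed.

Let mfst : measurable_fun [set: E * E] (@fst E E). Proof. exact: measurable_fst. Qed.
Let msnd : measurable_fun [set: E * E] (@snd E E). Proof. exact: measurable_snd. Qed.

Local Notation primal := (primal_cost Omega dx dy c eps mu nu l1 l2 t1 t2).
Local Notation dual := (dual_value Omega dx dy c eps mu nu l1 l2 t1 t2).

Let mgibbs : measurable_fun OO (gibbs c eps).
Proof.
apply: measurableT_comp => //; apply: measurable_funM => //.
exact: measurableT_comp.
Qed.

Let dual_integral phi psi phi' psi' :
  measurable_fun [set: E] phi -> measurable_fun [set: E] psi ->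
  bm phi' -> bm psi' ->
  {ae dx, forall x, phi x = phi' x} -> {ae dy, forall y, psi y = psi' y} ->
  (\int[rho]_(z in OO) ((expR ((phi z.1 + psi z.2) / eps) - 1) * gibbs c eps z)%:E
  = (\int[rho]_z ((expR ((phi' z.1 + psi' z.2) / eps) - 1) * K z))%:E)%E.
Proof.
move=> mphi mpsi bphi bpsi ephi epsi.
have bK : bm K := gibbs_bm eps0 mC C0.
have bi := bm_dual_integrand mfst msnd eps bK bphi bpsi.
rewrite (integral_conull (g := fun z =>
  ((expR ((phi' z.1 + psi' z.2) / eps) - 1) * K z)%:E) mOO rhoOO).
- by rewrite Rint_EFin//; exact: bm_L1_prob.
- by apply/measurable_EFinP; case: bi.
- have e1 := ae_marginal (rho := (dx \x dy)%E) mfst (product_fst dx dy) ephi.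
  have e2 := ae_marginal (rho := (dx \x dy)%E) msnd (product_snd dx dy) epsi.
  apply: filterS2 e1 e2 => z -> -> OOz.
  by rewrite /gibbs patchE mem_set.
- apply/measurable_EFinP; apply: measurable_funM => //.
  apply: measurable_funTS; apply: measurable_funB => //.
  apply: measurableT_comp => //; apply: measurable_funM => //.
  apply: measurable_funD.
    exact: (measurableT_comp mphi mfst).
  exact: (measurableT_comp mpsi msnd).
Qed.

Let entropyE (gamma : {measure set (E * E) -> \bar R}) p :
  is_density gamma rho (density gamma rho) ->
  {ae rho, forall z, density gamma rho z = p z} -> measurable_fun [set: E * E] p ->
  entropy Omega dx dy gamma = (\int[rho]_z ((ln (p z) - 1) * p z)%:E)%E.
Proof.
move=> [mq _ _] qp mp.
have mh (q : E * E -> R) : measurable_fun [set: E * E] q ->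
    measurable_fun [set: E * E] (fun z => ((ln (q z) - 1) * q z)%:E).
  move=> mq'; apply/measurable_EFinP/measurable_funM => //.
  by apply: measurable_funB => //; exact: (measurableT_comp (@measurable_ln R) mq').
rewrite /entropy; apply: integral_conull => //; first exact: mh.
  by apply: filterS qp => z -> .
by apply: measurable_funTS; exact: mh.
Qed.

Let costE (gamma : {measure set (E * E) -> \bar R}) : gamma (~` OO) = 0%E ->
  (\int[gamma]_(z in OO) (c z)%:E = \int[gamma]_z (C z)%:E)%E.
Proof.
move=> gOO; apply: integral_conull_eq => //; first exact/measurable_EFinP.
by move=> z OOz; rewrite patchE mem_set.
Qed.

Lemma dual_le_primal (gamma : {measure set (E * E) -> \bar R}) phi psi :
  radon_on OO gamma -> gamma `<< rho ->
  phi \in Lfun dx +oo%E -> psi \in Lfun dy +oo%E ->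
  (dual phi psi <= primal gamma
    + eps%:E * \int[rho]_(z in OO) (gibbs c eps z)%:E)%E.
Proof.
move=> gradon grho Lphi Lpsi.
have mphi : measurable_fun [set: E] phi by have := sub_Lfun_mfun Lphi; rewrite inE.
have mpsi : measurable_fun [set: E] psi by have := sub_Lfun_mfun Lpsi; rewrite inE.
have [phi' [bphi ephi]] := Lfun_infty_bm Lphi.
have [psi' [bpsi epsi]] := Lfun_infty_bm Lpsi.
have dgamma := plan_density_exists gradon grho.
rewrite /dual_value (dual_integral mphi mpsi bphi bpsi ephi epsi).
have [->|[-> phi_ge]] := dual_termP mOmega dx_Omega l1_meas bl1 muoo df t1 mphi bphi ephi.
  rewrite addeNy addNye leNye//.
have [->|[-> psi_ge]] := dual_termP mOmega dy_Omega l2_meas bl2 nuoo dg t2 mpsi bpsi epsi.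
  by rewrite addeNy leNye.
have mp : measurable_fun [set: E * E] (density gamma rho) by case: dgamma.
have weak := weak_duality mfst (product_fst dx dy) msnd (product_snd dx dy)
  bl1 l10 bl2 l20 muoo nuoo df dg eps0 mC C0 dgamma bphi bpsi phi_ge psi_ge.
rewrite /primal_cost (costE gradon.1) (entropyE dgamma (aeW _ _) mp)//.
rewrite gibbs_integral -EFinM.
apply: le_trans weak; rewrite -?EFinM -EFinN -!EFinD lee_fin /dual_real.
have fi := is_density_L1 df muoo; have gi := is_density_L1 dg nuoo.
have bmin1 := bm_min bphi bl1; have bmin2 := bm_min bpsi bl2.
have -> : \int[dx]_x ((Num.min (phi' x) ((l1 \_ Omega) x) - phi' x) * f x) =
    \int[dx]_x (Num.min (phi' x) ((l1 \_ Omega) x) * f x) - \int[dx]_x (phi' x * f x).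
  by rewrite -RintB; [apply: Rint_eq => x; rewrite mulrBl|exact: L1M..].
have -> : \int[dy]_y ((Num.min (psi' y) ((l2 \_ Omega) y) - psi' y) * g y) =
    \int[dy]_y (Num.min (psi' y) ((l2 \_ Omega) y) * g y) - \int[dy]_y (psi' y * g y).
  by rewrite -RintB; [apply: Rint_eq => x; rewrite mulrBl|exact: L1M..].
lra.
Qed.

(** The plan built from a near-maximiser is finite, so it is Radon, and its chosen
    density agrees almost everywhere with the explicit one. *)
Lemma primal_le_dual (e : R) : 0 < e ->
  exists (gamma : {measure set (E * E) -> \bar R}) phi psi,
  [/\ radon_on OO gamma /\ gamma `<< rho,
    phi \in Lfun dx +oo%E, psi \in Lfun dy +oo%E &
    (primal gamma + eps%:E * \int[rho]_(z in OO) (gibbs c eps z)%:E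
     <= dual phi psi + e%:E)%E].
Proof.
move=> e0.
have [M [phi [psi [gamma [p [M0 bphi bpsi [goo dp bcp bent] gap]]]]]] :=
  no_duality_gap mfst (product_fst dx dy) msnd (product_snd dx dy)
  bl1 l10 bl2 l20 muoo nuoo df dg eps0 mC C0 t1 t2 e0.
have bmi (h : E * E -> R) : bm h -> L1 rho h by exact: bm_L1_prob.
have grho : gamma `<< rho := is_density_dominates dp.
have gOO : gamma (~` OO) = 0%E.
  by apply: ((null_content_dominatesP _ _).1 grho) => //; exact: measurableC.
have gradon : radon_on OO gamma.
  split => // B cB _; apply: le_lt_trans goo; apply: le_measure; rewrite ?inE//.
  exact: compact_measurable_rV2.
have dgamma := plan_density_exists gradon grho.
have [cphi _] := bphi; have [cpsi _] := bpsi.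
exists gamma, phi, psi; split => //; [exact: bm_Lfun_infty|exact: bm_Lfun_infty|].
have [mp p0 _] := dp.
rewrite /primal_cost (costE gOO) (entropyE dgamma (is_density_unique goo dgamma dp) mp).
rewrite (is_density_integral_ge0 goo dp); last 2 first.
- exact/measurable_EFinP.
- by move=> z; rewrite lee_fin.
rewrite (Rint_EFin (f := fun z => C z * p z) (bmi _ bcp)) (Rint_EFin (bmi _ bent)).
rewrite gibbs_integral.
rewrite /dual_value (dual_integral _ _ cphi cpsi (aeW _ _) (aeW _ _))//; last 2 first.
- by case: cphi.
- by case: cpsi.
rewrite (dual_term_box mOmega dx_Omega bl1 muoo df l10 bphi).
rewrite (dual_term_box mOmega dy_Omega bl2 nuoo dg l20 bpsi).
rewrite -?EFinM -?EFinN -?EFinD.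
apply: le_trans gap.
set P1 := primal_penalty t1 _ _ _ _; set P2 := primal_penalty t2 _ _ _ _.
by rewrite (EFinD (_ + _)) -!addeA (addeC _ (P1 + P2)%E) -!addeA.
Qed.

Lemma strong_duality :
  (EGOPT Omega dx dy c eps mu nu l1 l2 t1 t2
    + eps%:E * \int[rho]_(z in OO) (gibbs c eps z)%:E
  = ereal_sup [set dual phi psi |
      phi in [set phi | phi \in Lfun dx +oo] &
      psi in [set psi | psi \in Lfun dy +oo]])%E.
Proof.
have epsKE : (eps%:E * \int[rho]_(z in OO) (gibbs c eps z)%:E)%E =
    (eps * \int[rho]_z K z)%:E by rewrite gibbs_integral.
apply/eqP; rewrite eq_le; apply/andP; split.
  apply/lee_addgt0Pr => e e0.
  have [gamma [phi [psi [gadm Lphi Lpsi le_e]]]] := primal_le_dual e0.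
  apply: (@le_trans _ _ (dual phi psi + e%:E)%E).
    apply: le_trans le_e; apply: leeD => //.
    by apply: ereal_inf_lbound; exists gamma.
  by apply: leeD => //; apply: ereal_sup_ubound; exists phi => //; exists psi.
apply: ub_ereal_sup => _ [phi Lphi [psi Lpsi <-]].
rewrite epsKE -leeBlDr//; apply: le_ereal_inf_tmp => _ [gamma [gradon grho] <-].
by rewrite leeBlDr// -epsKE; exact: dual_le_primal.
Qed.

End duality.

Theorem mainTheorem1 (R : realType) (d : nat) (Omega : set 'rV[R]_d)
  (Omega_nonempty : Omega !=set0) (Omega_open : open Omega)
  (Omega_convex : convex_set (Omega : set (convex_lmodType 'rV[R]_d)))
  (c : 'rV[R]_d * 'rV[R]_d -> R)
  (c_ge0 : forall z, (Omega `*` Omega) z -> 0 <= c z)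
  (c_lsc : lower_semicontinuous
     ((fun z => (c z)%:E) : subspace (Omega `*` Omega) -> \bar R))
  (dx dy : probability 'rV[R]_d R)
  (dx_Omega : dx (~` Omega) = 0%E) (dy_Omega : dy (~` Omega) = 0%E)
  (mu nu : {measure set 'rV[R]_d -> \bar R})
  (mu_radon : radon_on Omega mu) (nu_radon : radon_on Omega nu)
  (mu_dx : mu `<< dx) (nu_dy : nu `<< dy)
  (mu_L1 : density mu dx \in Lfun dx 1%E)
  (nu_L1 : density nu dy \in Lfun dy 1%E)
  (l1 l2 : 'rV[R]_d -> R)
  (l1_meas : measurable_fun Omega l1) (l2_meas : measurable_fun Omega l2)
  (l1_ge0 : forall x, Omega x -> 0 <= l1 x)
  (l2_ge0 : forall x, Omega x -> 0 <= l2 x)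
  (l1_bounded : exists M : R, forall x, Omega x -> l1 x <= M)
  (l2_bounded : exists M : R, forall x, Omega x -> l2 x <= M)
  (eps : R) (eps_gt0 : 0 < eps) (t1 t2 : penalty) :
  (EGOPT Omega dx dy c eps mu nu l1 l2 t1 t2
    + eps%:E * \int[dx \x dy]_(z in Omega `*` Omega) (gibbs c eps z)%:E
  = ereal_sup [set dual_value Omega dx dy c eps mu nu l1 l2 t1 t2 phi psi |
      phi in [set phi | phi \in Lfun dx +oo] &
      psi in [set psi | psi \in Lfun dy +oo]])%E.
Proof.
exact: (strong_duality Omega_open c_ge0 c_lsc dx_Omega dy_Omega eps_gt0
  mu_radon nu_radon mu_dx nu_dy mu_L1 nu_L1 l1_meas l2_meas l1_ge0 l2_ge0
  l1_bounded l2_bounded).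
Qed.
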